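(* Let $k$ be a field of characteristic zero, let $m,r$ be integers with $0\leq r\leq m-2$, let $1\leq t\leq m$, and let $\bar{R}=k[x_1,\ldots,x_{2m-r-1}]$. Then: (i) $\operatorname{codim} I_t(\mathcal{H}_m[r])=\min\{2(m-t)+1,\ 2m-t-r\}$, and $\bar{R}/I_t(\mathcal{H}_m[r])$ is a Cohen--Macaulay ring. (ii) $I_t(\mathcal{H}_m[r])$ is a prime ideal if and only if either $t=1$ or else $t\geq r+2$.
   Context: $\mathcal{H}_m[r]$ denotes the $m\times m$ matrix over $\bar R$ whose $(i,j)$ entry is the variable $x_{i+j-1}$ if $i+j\leq 2m-r$ and $0$ if $i+j>2m-r$. For a matrix $\mathcal{M}$, $I_t(\mathcal{M})$ denotes the ideal generated by its $t\times t$ minors; here it is an ideal of $\bar{R}$. Codimension of an ideal means its height. *)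

(* Defs.v *)
From HB Require Import structures.
From mathcomp Require Import all_boot all_order all_algebra.
From mathcomp Require Import boolp mpoly.

Set Implicit Arguments.
Unset Strict Implicit.
Unset Printing Implicit Defensive.

Import GRing.Theory.

Local Open Scope ring_scope.

(* [idealr_closed] of ring_quotient includes properness, so that everywhere
   below a prime or maximal ideal is proper.  Ideals are boolean predicates;
   [asbool] makes every Prop-valued predicate available as such. *)

Definition ideal_gen (R : comNzRingType) (G : R -> Prop) : {pred R} :=
  fun x => `[< exists2 s : seq (R * R),
                 (forall p, p \in s -> G p.2) & x = \sum_(p <- s) p.1 * p.2 >].

Definition seq_ideal (R : comNzRingType) (s : seq R) : {pred R} :=
  ideal_gen (fun x => x \in s).

Definition prime_ideal (R : comNzRingType) (P : {pred R}) : Prop :=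
  idealr_closed P /\ prime_idealr_closed P.

Definition maximal_ideal (R : comNzRingType) (P : {pred R}) : Prop :=
  idealr_closed P /\
  forall J : {pred R}, idealr_closed J -> {subset P <= J} -> {subset J <= P}.

Definition strict_subset (R : comNzRingType) (I J : {pred R}) : Prop :=
  {subset I <= J} /\ ~ {subset J <= I}.

(* There is a chain of primes P_0 < P_1 < ... < P_h = P. *)
Definition prime_chain_below (R : comNzRingType) (P : {pred R}) (h : nat) :=
  exists C : nat -> {pred R},
    [/\ forall i, (i <= h)%N -> prime_ideal (C i),
        forall i, (i < h)%N -> strict_subset (C i) (C i.+1)
      & C h =i P].

Definition prime_height (R : comNzRingType) (P : {pred R}) (h : nat) : Prop :=
  prime_chain_below P h /\ forall l, prime_chain_below P l -> (l <= h)%N.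

(* "The height of I is h", the height of I being the least height of a prime
   containing I.  A prime with no [prime_height] has infinite height, hence
   does not affect the minimum; the unit ideal has no height. *)
Definition codim (R : comNzRingType) (I : {pred R}) (h : nat) : Prop :=
  (exists P : {pred R},
     [/\ prime_ideal P, {subset I <= P} & prime_height P h]) /\
  (forall (P : {pred R}) (h' : nat),
     prime_ideal P -> {subset I <= P} -> prime_height P h' -> (h <= h')%N).

Definition regular_sequence (R : comNzRingType) (s : seq R) : Prop :=
  (forall i, (i < size s)%N -> forall x : R,
     s`_i * x \in seq_ideal (take i s) -> x \in seq_ideal (take i s)) /\
  1 \notin seq_ideal s.

(* "The depth of the ideal I (on R) is d": d is the largest length of a
   regular sequence of R contained in I. *)
Definition depth (R : comNzRingType) (I : {pred R}) (d : nat) : Prop :=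
  (exists s : seq R,
     [/\ regular_sequence s, {subset s <= I} & size s = d]) /\
  (forall s : seq R,
     regular_sequence s -> {subset s <= I} -> (size s <= d)%N).

(* Only proper ideals are considered: the unit ideal is generated by 1. *)
Definition noetherian (R : comNzRingType) : Prop :=
  forall J : {pred R}, idealr_closed J -> exists s : seq R, J =i seq_ideal s.

(* Eisenbud, Commutative Algebra, Section 18.2: a noetherian ring such that
   depth(P) = codim(P) for every maximal ideal P. *)
Definition cohen_macaulay (R : comNzRingType) : Prop :=
  noetherian R /\
  forall P : {pred R}, maximal_ideal P ->
    exists2 d : nat, depth P d & codim P d.

Definition idealr_of (R : comNzRingType) (I : {pred R})
    (hI : idealr_closed I) : idealr R :=
  HB.pack (I : R -> bool) (isIdealr.Build R I hI).

(* The ring R / I; it is a [comNzRingType] because [hI] makes I proper. *)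
Definition quotient_ring (R : comNzRingType) (I : {pred R})
    (hI : idealr_closed I) : comNzRingType :=
  {ideal_quot (idealr_of hI)}.

Definition is_minor (R : comNzRingType) (m n t : nat) (M : 'M[R]_(m, n))
    (x : R) : Prop :=
  exists (f : 'I_t -> 'I_m) (g : 'I_t -> 'I_n),
    [/\ forall i j : 'I_t, (i < j)%N -> (f i < f j)%N,
        forall i j : 'I_t, (i < j)%N -> (g i < g j)%N
      & x = \det (mxsub f g M)].

Definition minors_ideal (R : comNzRingType) (m n t : nat) (M : 'M[R]_(m, n)) :
    {pred R} :=
  ideal_gen (is_minor t M).

(* Indices are shifted to start at 0: the variable x_l is 'X_(l - 1), and the
   entry at (i, j), which is x_(i + j - 1) for i + j <= 2m - r and 0 otherwise
   when counting from 1, becomes 'X_(i + j) for i + j < 2m - r - 1 and 0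
   otherwise. *)
Definition hankel (k : fieldType) (m r : nat) :
    'M[{mpoly k[2 * m - r - 1]}]_m :=
  \matrix_(i < m, j < m)
    match (insub (i + j)%N : option 'I_(2 * m - r - 1)) with
    | Some l => 'X_l
    | None => 0
    end.

(* Main.v *)
From HB Require Import structures.
Require Import Defs.
From mathcomp Require Import all_boot all_order all_fingroup all_algebra.
From mathcomp Require Import boolp mpoly zify.
From mathcomp Require classical_sets.

(* Write s = t - 1, n = 2m - r - 1 and N = min (2m - t, n).  Shifting p rows of
   a minor of a Hankel matrix, in all possible ways, gives the same sum as
   shifting p columns; it follows that I_t is generated by the maximal minors of
   the t x N matrix with entries x_(i + j) (zero for i + j >= n).  Give x_i the
   weight i^2: the term of least weight of a maximal minor is its antidiagonal
   term, and the antidiagonal terms are all the monomials of degree t in the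
   "middle" variables x_s, ..., x_(N-1).  The Plucker-type relations expressing
   that a determinant with a repeated row vanishes allow one to straighten every
   multiple of a minor, so that the minors behave like a Groebner basis: the
   monomials of degree < t in the middle variables form a basis of R / I_t over
   the polynomial ring A in the other d = n - N + s variables.

   A finite free algebra R / I over a polynomial ring A in d variables is
   Cohen-Macaulay and I has height n - d: regular sequences of A stay regular,
   and every maximal ideal of A contains one of length d (Noether
   normalization); a regular sequence in a prime gives a chain of primes below
   it; and chains of primes have length at most d because any d + 1 elements of
   a finite A-algebra are algebraically dependent.

   For t >= r + 2 the s x s minor delta with antidiagonal x_N^s is regular
   modulo I_t, by the same weight argument, and after inverting delta every x_i
   becomes a polynomial in the last d variables modulo I_t.  Hence I_t is the
   kernel of the map to the fraction field of the polynomial ring in these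
   variables which extends the generic sequence by the linear recurrence of
   order s it determines.  If 2 <= t <= r + 1, then I_t contains x_(n-1)^t but
   not x_(n-1). *)

Set Implicit Arguments.
Unset Strict Implicit.
Unset Printing Implicit Defensive.

Import GRing.Theory.

Local Open Scope ring_scope.

(** * Ideals and regular sequences *)

Section Ideals.
Variable R : comNzRingType.
Implicit Types (I J P : {pred R}) (s : seq R).

(* Unlike [idealr_closed], this allows the unit ideal. *)
Definition weak_ideal I :=
  0 \in I /\ forall a, {in I &, forall u v, a * u + v \in I}.

Lemma idealr_closed_weak I : idealr_closed I -> weak_ideal I.
Proof. by case. Qed.

Lemma weak_ideal_closed I : weak_ideal I -> 1 \notin I -> idealr_closed I.
Proof. by case. Qed.

Section WeakIdeal.
Variables (I : {pred R}) (hI : weak_ideal I).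

Lemma wi0 : 0 \in I. Proof. by case: hI. Qed.
Lemma wiD u v : u \in I -> v \in I -> u + v \in I.
Proof. by move=> hu hv; rewrite -[u]mul1r; case: hI => _; apply. Qed.
Lemma wiM a u : u \in I -> a * u \in I.
Proof. by move=> hu; rewrite -[a * u]addr0; case: hI => h0; apply. Qed.
Lemma wiN u : u \in I -> - u \in I.
Proof. by move=> hu; rewrite -mulN1r wiM. Qed.
Lemma wiB u v : u \in I -> v \in I -> u - v \in I.
Proof. by move=> hu hv; rewrite wiD ?wiN. Qed.
Lemma wi_sum (T : Type) (r : seq T) (Q : pred T) (F : T -> R) :
  (forall i, Q i -> F i \in I) -> \sum_(i <- r | Q i) F i \in I.
Proof. by move=> h; elim/big_ind: _ => //; [exact: wi0 | exact: wiD]. Qed.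
Lemma wiBl u v : u - v \in I -> v \in I -> u \in I.
Proof. by move=> h hv; rewrite -[u](subrK v) wiD. Qed.

End WeakIdeal.

Lemma ideal_gen_weak (G : R -> Prop) : weak_ideal (ideal_gen G).
Proof.
split; first by apply/asboolP; exists [::]; rewrite ?big_nil.
move=> a u v /asboolP[s hs ->] /asboolP[s' hs' ->]; apply/asboolP.
exists ([seq (a * p.1, p.2) | p <- s] ++ s').
  move=> p; rewrite mem_cat => /orP[/mapP[q hq ->]|hp]; last exact: hs'.
    exact: (hs q).
rewrite big_cat big_map mulr_sumr; congr (_ + _).
by apply: eq_bigr => p _; rewrite mulrA.
Qed.

Lemma mem_ideal_gen (G : R -> Prop) x : G x -> x \in ideal_gen G.
Proof.
move=> Gx; apply/asboolP; exists [:: (1, x)]; last by rewrite big_seq1 mul1r.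
by move=> p; rewrite inE => /eqP ->.
Qed.

Lemma ideal_gen_min (G : R -> Prop) I :
  weak_ideal I -> (forall x, G x -> x \in I) -> {subset ideal_gen G <= I}.
Proof.
move=> hI hG x /asboolP[s hs ->]; rewrite big_seq; apply: wi_sum => // p hp.
by apply: wiM => //; apply/hG/hs.
Qed.

Lemma seq_ideal_weak s : weak_ideal (seq_ideal s).
Proof. exact: ideal_gen_weak. Qed.

Lemma seq_ideal_min s I : weak_ideal I -> {subset s <= I} ->
  {subset seq_ideal s <= I}.
Proof. by move=> hI hs; apply: ideal_gen_min. Qed.

Lemma mem_seq_ideal s x : x \in s -> x \in seq_ideal s.
Proof. exact: (@mem_ideal_gen (fun x => x \in s)). Qed.

Lemma seq_ideal_sub s s' : {subset s <= s'} -> {subset seq_ideal s <= seq_ideal s'}.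
Proof.
move=> h; apply: seq_ideal_min; first exact: seq_ideal_weak.
by move=> x /h; exact: mem_seq_ideal.
Qed.

Lemma seq_ideal_nil x : (x \in seq_ideal ([::] : seq R)) = (x == 0).
Proof.
apply/idP/eqP => [/asboolP[[|p s] hs ->]|->]; first by rewrite big_nil.
  by have := hs p (mem_head _ _).
exact: wi0 (seq_ideal_weak _).
Qed.

Lemma seq_ideal_rcons s a x :
  (x \in seq_ideal (rcons s a)) <-> exists b, x - b * a \in seq_ideal s.
Proof.
split=> [|[b hb]]; last first.
  rewrite -[x](subrK (b * a)); apply: (wiD (seq_ideal_weak _)).
    by apply: seq_ideal_sub hb => y hy; rewrite mem_rcons inE hy orbT.
  by apply: (wiM (seq_ideal_weak _)); rewrite mem_seq_ideal ?mem_rcons ?mem_head.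
pose J : {pred R} := fun x => `[< exists b, x - b * a \in seq_ideal s >].
have hJ : weak_ideal J.
  split=> [|c u v /asboolP[b hb] /asboolP[b' hb']]; apply/asboolP.
    by exists 0; rewrite mul0r subr0 (wi0 (seq_ideal_weak _)).
  exists (c * b + b').
  have -> : c * u + v - (c * b + b') * a = c * (u - b * a) + (v - b' * a).
    by rewrite mulrDl opprD mulrBr mulrA addrACA.
  by case: (seq_ideal_weak s) => _; apply.
move/(seq_ideal_min hJ) => h; apply/asboolP/h => y.
rewrite mem_rcons inE => /orP[/eqP ->|hy]; apply/asboolP.
  by exists 1; rewrite mul1r subrr (wi0 (seq_ideal_weak _)).
by exists 0; rewrite mul0r subr0 mem_seq_ideal.
Qed.

Lemma seq_idealP s x :
  (x \in seq_ideal s) <-> exists c : nat -> R, x = \sum_(i < size s) c i * s`_i.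
Proof.
split=> [|[c ->]]; last first.
  apply: (wi_sum (seq_ideal_weak _)) => i _; apply: (wiM (seq_ideal_weak _)).
  by rewrite mem_seq_ideal ?mem_nth.
elim/last_ind: s x => [|s a IH] x.
  by rewrite seq_ideal_nil => /eqP ->; exists (fun=> 0); rewrite big_ord0.
move/seq_ideal_rcons=> [b /IH [c hc]].
exists (fun i => if (i < size s)%N then c i else b).
rewrite size_rcons big_ord_recr /= ltnn nth_rcons ltnn eqxx.
rewrite -[x in LHS](subrK (b * a)) hc; congr (_ + _); apply: eq_bigr => i _.
by rewrite ltn_ord nth_rcons ltn_ord.
Qed.

(** If u v is in P but u is not, then P + (u) is the unit ideal by maximality, and multiplying 1 = p
    + b u by v puts v in P. *)
Lemma maximal_prime P : maximal_ideal P -> prime_ideal P.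
Proof.
move=> [hP hmax]; split=> // u v huv; apply: contraT; rewrite negb_or => /andP[hu hv].
have wP := idealr_closed_weak hP.
pose J : {pred R} := fun x => `[< exists b, x - b * u \in P >].
have hJ1 : 1 \notin J.
  apply/negP => /asboolP[b hb]; move/negP: hv; apply.
  have -> : v = v * (1 - b * u) + b * (u * v).
    by rewrite mulrBr mulr1 [v * _]mulrC -mulrA subrK.
  by apply: (wiD wP); apply: (wiM wP).
have wJ : weak_ideal J.
  split=> [|c x y /asboolP[b hb] /asboolP[b' hb']]; apply/asboolP.
    by exists 0; rewrite mul0r subr0 (wi0 wP).
  exists (c * b + b').
  have -> : c * x + y - (c * b + b') * u = c * (x - b * u) + (y - b' * u).
    by rewrite mulrDl opprD mulrBr mulrA addrACA.
  by apply: (wiD wP) => //; apply: (wiM wP).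
case/negP: hu; apply: (hmax J); first exact: weak_ideal_closed.
  by move=> x hx; apply/asboolP; exists 0; rewrite mul0r subr0.
by apply/asboolP; exists 1; rewrite mul1r subrr (wi0 wP).
Qed.

(** Zorn's lemma gives an ideal containing I that is maximal among those disjoint from the
    multiplicative set S. It is prime: if u and v are not in P, then P + (u) and P + (v) meet S, and
    the product of the two witnesses would be in P if u v were. Maximality is part of the conclusion
    because [exists_maximal] needs it. *)
Lemma prime_avoidance I (S : R -> Prop) :
  weak_ideal I -> S 1 -> (forall x y, S x -> S y -> S (x * y)) ->
  (forall x, S x -> x \notin I) ->
  exists P, [/\ prime_ideal P, {subset I <= P}, (forall x, S x -> x \notin P)
    & forall J, weak_ideal J -> {subset P <= J} -> (forall x, S x -> x \notin J)
        -> {subset J <= P}].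
Proof.
move=> wI S1 SM IS.
pose good J := [/\ weak_ideal J, {subset I <= J} & forall x, S x -> x \notin J].
pose T := {J : {pred R} | `[< good J >]}.
have mkT J : good J -> `[< good J >] by move=> h; apply/asboolP.
have goodI : good I by split.
pose t0 : T := exist _ I (mkT _ goodI).
pose Rel (a b : T) := `[< {subset sval a <= sval b} >].
have [|a b c /asboolP ab /asboolP bc|A totA|[P gP] maxP] :=
    @classical_sets.ZL_preorder T t0 Rel.
- by move=> a; apply/asboolP.
- by apply/asboolP => x /ab /bc.
(* The empty chain is bounded by I, a nonempty one by its union. *)
- have [[a0 Aa0]|nA] := pselect (exists a, A a); last first.
    by exists t0 => a Aa; case: nA; exists a.
  pose U : {pred R} := fun x => `[< exists2 a, A a & x \in sval a >].
  have gU : good U.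
    split; last 2 first.
    - move=> x hx; apply/asboolP; exists a0 => //.
      by case: a0 {Aa0} => J /= /asboolP[_ h _]; exact: h.
    - move=> x Sx; apply/negP => /asboolP[[J /asboolP[_ _ h]] _ /=].
      exact/negP/h.
    split; first by apply/asboolP; exists a0 => //; case: a0 {Aa0} => J /= /asboolP[[]].
    move=> c u v /asboolP[a Aa ua] /asboolP[b Ab vb]; apply/asboolP.
    case: (totA a b Aa Ab) => /asboolP h.
      exists b => //; case: b {Ab} vb h => J /= /asboolP[[_ hJ] _ _] vb h.
      by apply: hJ => //; exact: h.
    exists a => //; case: a {Aa} ua h => J /= /asboolP[[_ hJ] _ _] ua h.
    by apply: hJ => //; exact: h.
  exists (exist _ U (mkT _ gU)) => a Aa; apply/asboolP => x hx /=.
  by apply/asboolP; exists a.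
have [wP IP SP] := asboolW gP.
have maxP' J : weak_ideal J -> {subset P <= J} -> (forall x, S x -> x \notin J) ->
    {subset J <= P}.
  move=> wJ PJ SJ.
  have gJ : good J by split=> // x /IP /PJ.
  have := maxP (exist _ J (mkT _ gJ)); rewrite /Rel /= => h.
  by apply/asboolP/h/asboolP.
exists P; split=> //; split.
  by apply: weak_ideal_closed => //; exact: SP.
move=> u v huv; apply: contraT; rewrite negb_or => /andP[hu hv].
pose J w : {pred R} := fun x => `[< exists b, x - b * w \in P >].
have wJ w : weak_ideal (J w).
  split=> [|c x y /asboolP[b hb] /asboolP[b' hb']]; apply/asboolP.
    by exists 0; rewrite mul0r subr0 (wi0 wP).
  exists (c * b + b').
  have -> : c * x + y - (c * b + b') * w = c * (x - b * w) + (y - b' * w).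
    by rewrite mulrDl opprD mulrBr mulrA addrACA.
  by apply: (wiD wP) => //; apply: (wiM wP).
have meet w : w \notin P -> exists x b, S x /\ x - b * w \in P.
  move=> hw; apply: contrapT => hn; case/negP: hw; apply: (maxP' (J w)) => //.
  - by move=> x hx; apply/asboolP; exists 0; rewrite mul0r subr0.
  - by move=> x Sx; apply/negP => /asboolP[b hb]; apply: hn; exists x, b.
  - by apply/asboolP; exists 1; rewrite mul1r subrr (wi0 wP).
have [x [b [Sx hx]]] := meet u hu; have [y [c [Sy hy]]] := meet v hv.
case/negP: (SP _ (SM _ _ Sx Sy)).
have -> : x * y = y * (x - b * u) + (b * u) * (y - c * v) + (b * c) * (u * v).
  rewrite mulrBr [y * x]mulrC [y * (b * u)]mulrC mulrBr.
  by rewrite addrA subrK [b * u * (c * v)]mulrACA subrK.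
by apply: (wiD wP); [apply: (wiD wP)|]; apply: (wiM wP).
Qed.

Lemma exists_maximal I : weak_ideal I -> 1 \notin I ->
  exists2 P, maximal_ideal P & {subset I <= P}.
Proof.
move=> wI I1.
have [|x y -> ->|x ->|P [[hP _] IP SP maxP]] := @prime_avoidance I (fun x => x = 1) wI.
- by [].
- by rewrite mulr1.
- by [].
exists P => //; split=> // J hJ PJ; apply: maxP => //; first exact: idealr_closed_weak.
by move=> x ->; case: hJ.
Qed.

(** The first clause of [regular_sequence]; properness comes for free when the sequence lies in a
    proper ideal. *)
Definition weakly_regular s := forall i, (i < size s)%N -> forall x,
  s`_i * x \in seq_ideal (take i s) -> x \in seq_ideal (take i s).

Lemma weakly_regular_rcons s a : weakly_regular (rcons s a) <->
  weakly_regular s /\ (forall x, a * x \in seq_ideal s -> x \in seq_ideal s).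
Proof.
split=> [h|[h ha] i].
  split=> [i hi x|x].
    have := h i; rewrite size_rcons ltnS (ltnW hi) => /(_ isT x).
    by rewrite nth_rcons hi -cats1 takel_cat // ltnW.
  have := h (size s); rewrite size_rcons ltnSn => /(_ isT x).
  by rewrite nth_rcons ltnn eqxx -cats1 take_size_cat.
rewrite size_rcons ltnS leq_eqVlt => /orP[/eqP ->|hi] x.
  by rewrite nth_rcons ltnn eqxx -cats1 take_size_cat //; exact: ha.
by rewrite nth_rcons hi -cats1 takel_cat ?(ltnW hi) //; exact: h.
Qed.

Lemma prime_chain_rcons Q P h : prime_chain_below Q h -> prime_ideal P ->
  strict_subset Q P -> prime_chain_below P h.+1.
Proof.
move=> [C [hC1 hC2 hC3]] hP [QP nPQ].
exists (fun i => if (i <= h)%N then C i else P); split; last by rewrite ltnn.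
  by move=> i _; case: ifP => // /hC1.
move=> i; rewrite ltnS => hi; rewrite hi; case: ifPn => [/hC2 //|].
rewrite -ltnNge ltnS => hi'; have -> : i = h by apply/anti_leq/andP.
split=> [x|h']; first by rewrite hC3; exact: QP.
by apply: nPQ => x /h'; rewrite hC3.
Qed.

(* Adding the powers of the last element [a] to the complement of P gives a
   multiplicative set which, [a] being regular modulo the other elements, still
   avoids the ideal generated by them. *)
Lemma regular_chain s P : weakly_regular s -> {subset s <= P} -> prime_ideal P ->
  prime_chain_below P (size s).
Proof.
elim/last_ind: s P => [|s a IH] P hs sP hP.
  by exists (fun=> P); split.
have [/IH {}IH ha] := (weakly_regular_rcons s a).1 hs.
have [hP1 hP2] := hP; have wP := idealr_closed_weak hP1.
have sP' : {subset s <= P} by move=> x hx; apply: sP; rewrite mem_rcons inE hx orbT.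
have aP : a \in P by apply: sP; rewrite mem_rcons mem_head.
pose S x := exists y k, y \notin P /\ x = y * a ^+ k.
have [||x _ [y [k [hy ->]]] [z [l [hz ->]]]|x [y [k [hy ->]]]|Q [hQ sQ QS _]] :=
    @prime_avoidance (seq_ideal s) S.
- exact: seq_ideal_weak.
- by exists 1, 0%N; rewrite expr0 mulr1; case: hP1.
- exists (y * z), (k + l)%N; rewrite exprD mulrACA; split=> //.
  by apply/negP => /hP2; rewrite (negPf hy) (negPf hz).
- apply: contra hy => hk; apply: (seq_ideal_min wP sP').
  by elim: k hk => [|k IHk]; rewrite ?mulr1 // exprS mulrCA => /ha.
have QP : {subset Q <= P}.
  move=> x hx; apply: contraT => nx.
  have /QS : S x by exists x, 0%N; rewrite expr0 mulr1.
  by rewrite hx.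
rewrite size_rcons; apply: prime_chain_rcons (IH Q _ hQ) hP _.
  by move=> x /mem_seq_ideal/sQ.
split=> // h; have /QS : S a.
  by exists 1, 1%N; rewrite expr1 mul1r; split=> //; case: hP1.
by rewrite h.
Qed.

End Ideals.

(** * Noetherian rings *)

Lemma noetherian_weak (R : comNzRingType) (J : {pred R}) :
  noetherian R -> weak_ideal J -> exists s : seq R, J =i seq_ideal s.
Proof.
move=> nR wJ; have [J1|J1] := boolP (1 \in J); last first.
  by apply: nR; apply: weak_ideal_closed.
exists [:: 1] => x.
by rewrite -[x]mulr1 !wiM // ?mem_seq_ideal ?mem_head //; exact: seq_ideal_weak.
Qed.

Lemma noetherian_surj (A B : comNzRingType) (f : {rmorphism A -> B}) :
  (forall b, exists a, b = f a) -> noetherian A -> noetherian B.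
Proof.
move=> surj nA J /idealr_closed_weak wJ.
pose J' : {pred A} := fun a => f a \in J.
have wJ' : weak_ideal J'.
  split=> [|a u v hu hv]; first by rewrite unfold_in rmorph0 (wi0 wJ).
  by rewrite unfold_in rmorphD rmorphM; case: wJ => _; apply.
have [s hs] := noetherian_weak nA wJ'.
exists (map f s) => x; apply/idP/idP => [hx|]; last first.
  apply: seq_ideal_min => // _ /mapP[a ha ->].
  by have := mem_seq_ideal ha; rewrite -hs.
have [a ea] := surj x; rewrite ea in hx *.
have : a \in seq_ideal s by rewrite -hs.
move/seq_idealP=> [c ->]; rewrite rmorph_sum; apply: (wi_sum (seq_ideal_weak _)) => i _.
rewrite rmorphM; apply: (wiM (seq_ideal_weak _)); apply: mem_seq_ideal.
by rewrite map_f ?mem_nth.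
Qed.

Lemma noetherian_field (k : fieldType) : noetherian k.
Proof.
move=> J [J0 J1 hJ]; exists [::] => x; rewrite seq_ideal_nil.
apply/idP/eqP => [hx|-> //]; apply/eqP; apply: contraNT J1 => x0.
by rewrite -[1]addr0 -(mulVf x0) hJ.
Qed.

(* Choose successively elements of least size outside of the ideal generated by
   the previous ones. *)
Lemma noetherian_poly (R : comNzRingType) : noetherian R -> noetherian {poly R}.
Proof.
move=> nR J /idealr_closed_weak wJ; apply: contrapT => nfg.
have step (s : seq {poly R}) : exists p, {subset s <= J} ->
    [/\ p \in J, p \notin seq_ideal s
      & forall q, q \in J -> q \notin seq_ideal s -> (size p <= size q)%N].
  have [sJ|nsJ] := pselect {subset s <= J}; last by exists 0.
  have [p0 [p0J p0s]] : exists p, p \in J /\ p \notin seq_ideal s.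
    apply: contrapT => h; apply: nfg; exists s => p; apply/idP/idP => [pJ|]; last first.
      exact: seq_ideal_min.
    by apply: contraT => ps; case: h; exists p.
  have ex : exists n, `[< exists p, [/\ p \in J, p \notin seq_ideal s & size p = n] >].
    by exists (size p0); apply/asboolP; exists p0.
  case: (ex_minnP ex) => n /asboolP[p [pJ ps sp]] hmin.
  exists p => _; split=> // q qJ qs; rewrite sp; apply: hmin.
  by apply/asboolP; exists q.
have [next hnext] := choice step.
pose F := fix F n : seq {poly R} := if n is n'.+1 then rcons (F n') (next (F n')) else [::].
have FJ n : {subset F n <= J}.
  elim: n => [|n IH] // p; rewrite mem_rcons inE => /orP[/eqP -> |]; last exact: IH.
  by case: (hnext _ IH).
have sF n : size (F n) = n by elim: n => //= n IH; rewrite size_rcons IH.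
have Fle m n : (m <= n)%N -> {subset F m <= F n}.
  elim: n => [|n IH]; first by rewrite leqn0 => /eqP ->.
  rewrite leq_eqVlt => /orP[/eqP -> //|/IH h] p /h hp /=.
  by rewrite mem_rcons inE hp orbT.
have Fnth i n : (i < n)%N -> (F n)`_i = next (F i).
  elim: n => // n IH; rewrite ltnS leq_eqVlt /= nth_rcons sF => /orP[/eqP ->|hi].
    by rewrite ltnn eqxx.
  by rewrite hi IH.
pose lc n := map lead_coef (F n).
(* The leading coefficients of the chosen polynomials generate an increasing sequence of ideals; its
   union [L] is finitely generated, hence reached at some stage [N]. *)
pose L : {pred R} := fun x => `[< exists n, x \in seq_ideal (lc n) >].
have lcle m n : (m <= n)%N -> {subset seq_ideal (lc m) <= seq_ideal (lc n)}.
  move=> mn; apply: seq_ideal_sub => _ /mapP[p hp ->]; apply: map_f.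
  exact: Fle hp.
have wL : weak_ideal L.
  split; first by apply/asboolP; exists 0%N; rewrite (wi0 (seq_ideal_weak _)).
  move=> a u v /asboolP[m hm] /asboolP[n hn]; apply/asboolP; exists (maxn m n).
  case: (seq_ideal_weak (lc (maxn m n))) => _; apply.
    by apply: lcle hm; rewrite leq_maxl.
  by apply: lcle hn; rewrite leq_maxr.
have [s hs] := noetherian_weak nR wL.
have [N hN] : exists N, {subset s <= seq_ideal (lc N)}.
  have : {subset s <= L} by move=> x /mem_seq_ideal; rewrite hs.
  elim: (s) => [|x s' IH] h; first by exists 0%N.
  have [n hn] := IH (fun y hy => h y (mem_behead (s := x :: s') hy)).
  have /asboolP[m hm] := h x (mem_head _ _).
  exists (maxn m n) => y; rewrite inE => /orP[/eqP ->|/hn hy].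
    by apply: lcle hm; rewrite leq_maxl.
  by apply: lcle hy; rewrite leq_maxr.
set f := next (F N); have [fJ fF fmin] := hnext _ (FJ N).
have : lead_coef f \in seq_ideal (lc N).
  apply: (seq_ideal_min (seq_ideal_weak _) hN); rewrite -hs.
  apply/asboolP; exists N.+1; apply: mem_seq_ideal; apply: map_f.
  by rewrite /= mem_rcons mem_head.
move/seq_idealP; rewrite size_map sF => -[c hc].
have f0 : f != 0.
  by apply: contraNneq fF; rewrite -/f => ->; rewrite (wi0 (seq_ideal_weak _)).
(* [g] has the leading term of [f] and lies in the ideal of [F N], so [f - g] is smaller than [f],
   in J and outside that ideal, against minimality. *)
pose g := \sum_(i < N) (c i *: 'X^(size f - size (F N)`_i)) * (F N)`_i.
have gF : g \in seq_ideal (F N).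
  apply: (wi_sum (seq_ideal_weak _)) => i _; apply: (wiM (seq_ideal_weak _)).
  by apply: mem_seq_ideal; rewrite mem_nth ?sF.
have szF (i : 'I_N) : (size ((F N)`_i)%R <= size f)%N.
  rewrite Fnth //; have [_ _] := hnext _ (FJ i); apply=> //.
  by apply: contra fF; apply: seq_ideal_sub; apply: Fle; exact: ltnW.
have: (size f <= size (f - g)%R)%N.
  apply: fmin.
    apply: (wiB wJ) => //; move: gF; apply: seq_ideal_min => //; exact: FJ.
  by apply: contra fF => /(wiBl (seq_ideal_weak _)); apply.
apply/negP; rewrite -ltnNge -(prednK (n := size f)) ?size_poly_gt0 // ltnS.
apply/leq_sizeP => j hj; rewrite coefB.
have F0 (i : 'I_N) : (0 < size ((F N)`_i)%R)%N.
  rewrite lt0n size_poly_eq0; apply/eqP => Fi0.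
  have [_ h _] := hnext _ (FJ i); move: h.
  by rewrite -(Fnth _ _ (ltn_ord i)) Fi0 (wi0 (seq_ideal_weak _)).
have -> : g`_j = \sum_(i < N) c i * ((F N)`_i)`_(j - (size f - size (F N)`_i)).
  rewrite coef_sum; apply: eq_bigr => i _.
  rewrite -scalerAl coefZ coefXnM ltnNge (leq_trans _ hj) //.
  by have := F0 i; have := szF i; case: (size _) => // a; case: (size _) => // b _ _; rewrite subSS leq_subr.
have [ej|nj] := eqVneq j (size f).-1.
  rewrite ej -/(lead_coef f) hc; apply/eqP; rewrite subr_eq0; apply/eqP.
  apply: eq_bigr => i _; congr (_ * _).
  rewrite (nth_map 0) ?sF // lead_coefE; congr (_`_ _).
  have := F0 i; have := szF i; case: (size _) => // a; case: (size _) => // b.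
  by rewrite ltnS => ab _ /=; rewrite subSS subKn.
have hj' : (size f <= j)%N.
  by rewrite -(prednK (n := size f)) ?size_poly_gt0 // ltn_neqAle eq_sym nj.
rewrite (nth_default _ hj') big1 ?subr0 // => i _.
rewrite nth_default ?mulr0 //; have := szF i; move: hj' => hj1 hj2.
by rewrite leq_subRL ?subnK // (leq_trans (leq_subr _ _)).
Qed.

Lemma eq_rmorph_mpoly (R : nzRingType) n (S : nzRingType)
    (f g : {rmorphism {mpoly R[n]} -> S}) :
  (forall c, f c%:MP = g c%:MP) -> (forall i, f 'X_i = g 'X_i) -> f =1 g.
Proof.
move=> hC hX p; rewrite (mpolyE p) !rmorph_sum; apply: eq_bigr => m _.
rewrite -mul_mpolyC !rmorphM hC; congr (_ * _).
rewrite mpolyXE_id !rmorph_prod; apply: eq_bigr => i _.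
by rewrite !rmorphXn hX.
Qed.

(** * Polynomial rings and chains of primes *)

Section PolyIso.
Variables (R : comNzRingType) (n : nat).

(** Together with its inverse [multim], this identifies polynomials in n + 1 variables with
    univariate polynomials over those in n variables, the last variable becoming X. *)
Definition munim : {rmorphism {mpoly R[n.+1]} -> {poly {mpoly R[n]}}} := @muni n R.

Lemma muni_max : munim 'X_ord_max = 'X.
Proof.
rewrite /= muniE msuppX big_seq1 mcoeffX eqxx scale1r mnm1E eqxx expr1.
have -> : [multinom U_(ord_max)%MM (widen_ord (leqnSn n) i) | i < n] = 0%MM :> 'X_{1..n}.
  by apply/mnmP => i; rewrite mnmE mnm1E mnm0E -val_eqE /= gtn_eqF.
by rewrite mpolyX0 scale1r.
Qed.

Lemma muni_widen (i : 'I_n) : munim 'X_(widen_ord (leqnSn n) i) = ('X_i)%:P.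
Proof.
rewrite /= muniE msuppX big_seq1 mcoeffX eqxx scale1r mnm1E.
rewrite -val_eqE /= ltn_eqF // expr0 alg_polyC; congr ('X_[_])%:P.
by apply/mnmP => j; rewrite mnmE !mnm1E -!val_eqE.
Qed.

Definition multim : {rmorphism {poly {mpoly R[n]}} -> {mpoly R[n.+1]}} :=
  horner_morph (fun x => mulrC ('X_ord_max : {mpoly R[n.+1]}) (mwiden x)).

Lemma multim_C p : multim p%:P = mwiden p.
Proof. exact: horner_morphC. Qed.

Lemma multim_X : multim 'X = 'X_ord_max.
Proof. exact: horner_morphX. Qed.

Lemma mwiden_X (i : 'I_n) : mwiden ('X_i : {mpoly R[n]}) = 'X_(widen_ord (leqnSn n) i).
Proof. by rewrite mwidenX mnmwiden1. Qed.

Lemma ord_max_widen (P : 'I_n.+1 -> Prop) :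
  P ord_max -> (forall i : 'I_n, P (widen_ord (leqnSn n) i)) -> forall i, P i.
Proof.
move=> hmax hw i; have [lt|ge] := ltnP i n.
  by have := hw (Ordinal lt); congr P; apply: val_inj.
by have <- : ord_max = i by apply/val_inj/anti_leq; rewrite /= ge -ltnS ltn_ord.
Qed.

Lemma muniK : cancel munim multim.
Proof.
move=> p; apply: (@eq_rmorph_mpoly R n.+1 _ (multim \o munim) idfun) => [c|i] /=.
  by rewrite muniC multim_C mwidenC.
elim/ord_max_widen: i => [|i].
  by have /= -> := muni_max; rewrite multim_X.
by have /= -> := muni_widen i; rewrite multim_C mwiden_X.
Qed.

Lemma poly_rmorph_eq (A : comNzRingType) (B : nzRingType) (f g : {rmorphism {poly A} -> B}) :
  (forall c, f c%:P = g c%:P) -> f 'X = g 'X -> f =1 g.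
Proof.
move=> hC hX p; rewrite -[p]coefK poly_def !rmorph_sum; apply: eq_bigr => i _.
by rewrite -mul_polyC !rmorphM !rmorphXn hX hC.
Qed.

Lemma multiK : cancel multim munim.
Proof.
apply: (@poly_rmorph_eq _ _ (munim \o multim) idfun) => [c|] /=.
  rewrite multim_C.
  have h := @eq_rmorph_mpoly R n _ (munim \o @mwiden n R) (@polyC {mpoly R[n]}).
  apply: h => [a|i] /=; first by rewrite mwidenC muniC.
  by rewrite mwiden_X; exact: muni_widen.
by rewrite multim_X; exact: muni_max.
Qed.

End PolyIso.

(** * Regular sequences in univariate polynomial rings *)

Section PolyRegular.
Variable R : comNzRingType.

Lemma mem_seq_ideal_polyC (s : seq R) (p : {poly R}) :
  (p \in seq_ideal (map polyC s)) <-> (forall i, p`_i \in seq_ideal s).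
Proof.
split=> [/seq_idealP[c ->] i|h].
  rewrite coef_sum; apply: (wi_sum (seq_ideal_weak _)) => j _.
  move: (ltn_ord j); rewrite [X in (_ < X)%N]size_map => hj.
  rewrite (nth_map 0) // mulrC coefCM mulrC.
  by apply: (wiM (seq_ideal_weak _)); rewrite mem_seq_ideal ?mem_nth.
rewrite -[p]coefK poly_def; apply: (wi_sum (seq_ideal_weak _)) => i _.
rewrite -mul_polyC mulrC; apply: (wiM (seq_ideal_weak _)).
have /seq_idealP[c ->] := h i.
rewrite rmorph_sum; apply: (wi_sum (seq_ideal_weak _)) => j _.
rewrite rmorphM; apply: (wiM (seq_ideal_weak _)).
by apply: mem_seq_ideal; rewrite map_f ?mem_nth.
Qed.

(** The coefficient of [f * p] in degree deg f + j is p_j plus multiples of higher coefficients of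
    p, as f is monic; so the coefficients of p lie in the ideal of s by descending induction on
    j. *)
Lemma weakly_regular_monic (s : seq R) (f : {poly R}) : f \is monic ->
  weakly_regular s -> weakly_regular (rcons (map polyC s) f).
Proof.
move=> mf hs; apply/weakly_regular_rcons; split=> [i|p].
  rewrite size_map => hi p; rewrite -map_take (nth_map 0) //.
  move=> /mem_seq_ideal_polyC h; apply/mem_seq_ideal_polyC => j.
  by apply: hs => //; have := h j; rewrite coefCM.
move=> /mem_seq_ideal_polyC h; apply/mem_seq_ideal_polyC.
have wJ := seq_ideal_weak s.
suff H m : forall j, (size p <= j + m)%N -> p`_j \in seq_ideal s.
  by move=> j; apply: (H (size p)); rewrite leq_addl.
elim: m => [|m IH] j; rewrite ?addn0 => hj.
  by rewrite nth_default // (wi0 wJ).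
have := h ((size f).-1 + j)%N; rewrite coefM.
have lt : ((size f).-1 < ((size f).-1 + j).+1)%N by rewrite ltnS leq_addr.
rewrite (bigD1 (Ordinal lt)) //= addKn -lead_coefE (monicP mf) mul1r.
move/(wiBl wJ (u := _)) => -> //.
set S := \sum_(i | _) _.
suff hS : S \in seq_ideal s.
  by rewrite opprD addrA subrr sub0r; apply: (wiN wJ).
apply: (wi_sum wJ) => i hi.
have [lti|gei] := ltnP i (size f).-1; last first.
  rewrite nth_default ?mul0r ?(wi0 wJ) //.
  have sf : (0 < size f)%N by rewrite lt0n size_poly_eq0 monic_neq0.
  have : ((size f).-1 < i)%N by rewrite ltn_neqAle gei andbT eq_sym -val_eqE in hi *.
  by move=> /(leq_trans _); apply; rewrite prednK.
apply: (wiM wJ); apply: IH.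
move: (nat_of_ord i) lti hj => i'; move: (size p) (size f).-1 => a b; clear; lia.
Qed.

End PolyRegular.

Lemma weakly_regular_iso (A B : comNzRingType) (f : {rmorphism A -> B})
    (g : {rmorphism B -> A}) (s : seq A) :
  cancel f g -> cancel g f -> weakly_regular s -> weakly_regular (map f s).
Proof.
move=> fK gK.
have mem (r : seq A) x : (x \in seq_ideal (map f r)) <-> (g x \in seq_ideal r).
  split=> [/seq_idealP[c ->]|/seq_idealP[c e]].
    rewrite rmorph_sum; apply: (wi_sum (seq_ideal_weak _)) => j _.
    move: (ltn_ord j); rewrite [X in (_ < X)%N]size_map => hj.
    rewrite (nth_map 0) // rmorphM fK.
    by apply: (wiM (seq_ideal_weak _)); rewrite mem_seq_ideal ?mem_nth.
  rewrite -[x]gK e rmorph_sum; apply: (wi_sum (seq_ideal_weak _)) => j _.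
  rewrite rmorphM; apply: (wiM (seq_ideal_weak _)).
  by rewrite mem_seq_ideal ?map_f ?mem_nth.
move=> hs i; rewrite size_map => hi x; rewrite -map_take (nth_map 0) //.
by move/mem; rewrite rmorphM fK => h; apply/mem/hs.
Qed.

(* A chain P_0 < ... < P_e with f_i in P_(i+1) but not in P_i: an algebraic
   relation between the f_i is, after factoring out a power of the last
   variable, sent into P_1 up to a multiple of f_0, which allows an induction. *)
Lemma chain_alg_indep (k : fieldType) (B : comNzRingType) (c : {rmorphism k -> B})
    e (C : nat -> {pred B}) (f : 'I_e -> B) :
  (forall i, (i <= e)%N -> prime_ideal (C i)) ->
  (forall i, (i < e)%N -> {subset C i <= C i.+1}) ->
  (forall i : 'I_e, f i \in C (e - i)%N /\ f i \notin C (e - i.+1)%N) ->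
  forall F : {mpoly k[e]}, F != 0 -> mmap c f F \notin C 0%N.
Proof.
elim: e C f => [|e IH] C f hC sC hf F F0.
  have [/idealr_closed_weak wC _] := hC 0%N isT; have [[_ h1 _] _] := hC 0%N isT.
  rewrite (nvar0_mpolyC F) mmapC; apply: contra h1 => h.
  have c0 : F@_0 != 0 by rewrite -(mpolyC_eq0 0) -nvar0_mpolyC.
  by rewrite -(rmorph1 c) -(mulVf c0) rmorphM (wiM wC).
pose f' i := f (widen_ord (leqnSn e) i).
pose G := munim k e F.
have G0 : G != 0 by rewrite -(rmorph0 (munim k e)) (can_eq (@muniK k e)).
pose h : {rmorphism {poly {mpoly k[e]}} -> B} :=
  horner_morph (fun x => mulrC (f ord_max) (mmap c f' x)).
have hG : mmap c f F = h G.
  have e1 := @eq_rmorph_mpoly k e.+1 B (mmap c f) (h \o munim k e).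
  apply: e1 => [a|i] /=.
    by rewrite mmapC muniC horner_morphC /= mmapC.
  rewrite mmapX mmap1U; elim/ord_max_widen: i => [|i].
    by have /= -> := muni_max k e; rewrite horner_morphX.
  by have /= -> := muni_widen k i; rewrite horner_morphC /= mmapX mmap1U.
rewrite hG.
have [hP0 hP0'] := hC 0%N isT; have wP0 := idealr_closed_weak hP0.
have [hP1 hP1'] := hC 1%N isT; have wP1 := idealr_closed_weak hP1.
(* The indices of [f] run against those of the chain: the last element is in [C 1] but not in
   [C 0]. *)
have [fP fN] := hf ord_max; rewrite /= subSnn subnn in fP fN.
(* Write the polynomial as G X + a. If a = 0, the image of X is outside the prime [C 0] and is
   cancelled. Otherwise a value in [C 0] would put the value of a in [C 1], which the induction
   hypothesis for the chain starting at [C 1] excludes. *)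
elim/poly_ind: {F F0 hG} G G0 => [|G a IHG]; first by rewrite eqxx.
rewrite rmorphD rmorphM /= horner_morphX horner_morphC /=.
have [-> G0|a0 _] := eqVneq a 0.
  rewrite rmorph0 addr0; apply/negP => /hP0'; rewrite (negPf fN) orbF.
  apply/negP/IHG; apply: contraNneq G0 => ->; rewrite mul0r add0r; exact/eqP.
have : mmap c f' a \notin C 1%N.
  apply: (IH (fun i => C i.+1)) => // [i hi|i hi|i]; [exact: hC|exact: sC|].
  by have [] := hf (widen_ord (leqnSn e) i); rewrite /= !subSn // ltnW.
apply: contra => /(sC 0%N isT) h1.
rewrite -[mmap c f' a](addrK (horner_morph (fun x => mulrC (f ord_max) (mmap c f' x)) G * f ord_max)).
apply: (wiB wP1); first by rewrite addrC.
exact: (wiM wP1).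
Qed.

(** In a chain longer than d, elements chosen in the first d + 1 successive differences satisfy no
    algebraic relation, even modulo the first prime. *)
Lemma prime_chain_bound (k : fieldType) (B : comNzRingType) (c : {rmorphism k -> B}) d
    (P : {pred B}) l :
  (forall f : 'I_d.+1 -> B, exists2 F : {mpoly k[d.+1]}, F != 0 & mmap c f F = 0) ->
  prime_chain_below P l -> (l <= d)%N.
Proof.
move=> dep [C [hC1 hC2 hC3]]; rewrite leqNgt; apply/negP => ltd.
have ex (i : 'I_d.+1) : exists x, x \in C (d.+1 - i)%N /\ x \notin C (d.+1 - i.+1)%N.
  have lti : (d.+1 - i.+1 < l)%N by rewrite (leq_trans _ ltd) // subSS ltnS leq_subr.
  have [h1 h2] := hC2 _ lti; apply: contrapT => h; apply: h2 => x.
  rewrite -subSn ?ltn_ord // subSS => hx; apply: contraT => nx; case: h; exists x.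
  by split.
have [f hf] := choice ex; have [F F0 hF] := dep f.
have := @chain_alg_indep k B c d.+1 C f.
case/(_ _ _ hf F F0)/negP => //.
- by move=> i hi; apply: hC1; apply: leq_trans hi ltd.
- by move=> i hi; case: (hC2 i); first exact: leq_trans hi ltd.
rewrite hF; have [|/idealr_closed_weak wC _] := hC1 0%N; first by [].
exact: wi0 wC.
Qed.

(** * Finite extensions *)

Section QuotientProj.
Variables (R : comNzRingType) (I : {pred R}) (hI : idealr_closed I).

Definition qproj : {rmorphism R -> quotient_ring hI} :=
  \pi_{ideal_quot (idealr_of hI)}%qT.

Lemma qproj_eq0 x : (qproj x == 0) = (x \in I).
Proof.
rewrite -(rmorph0 qproj) /qproj /=.
by have /= <- := @Quotient.idealrBE _ (idealr_of hI) x 0; rewrite subr0.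
Qed.

Lemma qproj_surj y : exists x, y = qproj x.
Proof. by exists (generic_quotient.repr y); rewrite /qproj /= reprK. Qed.

End QuotientProj.

Section FiniteExtension.
Variables (A B : comNzRingType) (f : {rmorphism A -> B}).
Variables (q : nat) (e : 'I_q -> B).

(* If x b = 1 modulo Q then b acts on the generators through a matrix M, and
   det (1 - x M), which is 1 modulo x, lies in Q. *)
Lemma maximal_contraction (Q : {pred B}) :
  (forall b, exists a : 'I_q -> A, b - \sum_j f (a j) * e j \in Q) ->
  maximal_ideal Q -> maximal_ideal (fun a => f a \in Q).
Proof.
move=> span [hQ maxQ]; have wQ := idealr_closed_weak hQ.
have [_ Q1 _] := hQ; set P : {pred A} := fun a => f a \in Q.
have PE a : (a \in P) = (f a \in Q) by [].
split.
  split; rewrite ?PE ?rmorph0 ?(wi0 wQ) ?rmorph1 //.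
  move=> a u v hu hv; rewrite PE rmorphD rmorphM.
  by apply: (wiD wQ) => //; apply: (wiM wQ).
move=> J hJ PJ x xJ; apply: contraT => xP.
pose K : {pred B} := fun y => `[< exists b, y - b * f x \in Q >].
have wK : weak_ideal K.
  split=> [|c u v /asboolP[b hb] /asboolP[b' hb']]; apply/asboolP.
    by exists 0; rewrite mul0r subr0 (wi0 wQ).
  exists (c * b + b').
  have -> : c * u + v - (c * b + b') * f x = c * (u - b * f x) + (v - b' * f x).
    by rewrite mulrDl opprD mulrBr mulrA addrACA.
  by apply: (wiD wQ) => //; apply: (wiM wQ).
(* Were Q + (f x) proper, maximality of Q would put x in P. *)
have /asboolP[b hb] : 1 \in K.
  apply: contraNT xP => K1; rewrite PE; apply: (maxQ K).
  - exact: weak_ideal_closed.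
  - by move=> y hy; apply/asboolP; exists 0; rewrite mul0r subr0.
  - by apply/asboolP; exists 1; rewrite mul1r subrr (wi0 wQ).
have [M hM] := choice (fun j => span (b * e j)).
have [u hu] := span 1.
pose N : 'M[A]_q := 1%:M - x *: \matrix_(i, j) M i j.
(* Modulo Q the matrix [N] kills the vector of generators, since [b * f x] is 1 there. *)
have NQ i : \sum_j f (N i j) * e j \in Q.
  have -> : \sum_j f (N i j) * e j = e i * (1 - b * f x) +
      f x * (b * e i - \sum_j f (M i j) * e j).
    under eq_bigr => j _ do rewrite !mxE rmorphB rmorphM mulrBl.
    rewrite big_split /= (bigD1 i) //= eqxx rmorph1 mul1r big1 ?addr0; last first.
      by move=> j ji; rewrite eq_sym (negPf ji) rmorph0 mul0r.
    rewrite sumrN mulrBr mulr1 mulrBr addrA; congr (_ - _); last first.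
      by rewrite mulr_sumr; apply: eq_bigr => j _; rewrite mulrA.
    by rewrite [f x * _]mulrC [e i * _]mulrC mulrAC subrK.
  by apply: (wiD wQ); apply: (wiM wQ).
(* Multiplying by the adjugate, [\det N] kills every generator modulo Q, hence also 1. *)
have dQ : f (\det N) \in Q.
  have dj j : f (\det N) * e j \in Q.
    have -> : f (\det N) * e j = \sum_i f (\adj N j i) * (\sum_l f (N i l) * e l).
      under eq_bigr => i _ do rewrite mulr_sumr.
      rewrite exchange_big /=.
      under eq_bigr => l _ do (under eq_bigr => i _ do rewrite mulrA -rmorphM;
        rewrite -mulr_suml -rmorph_sum).
      have h l : \sum_i \adj N j i * N i l = \det N *+ (j == l).
        by have := mul_adj_mx N => /matrixP/(_ j l); rewrite !mxE.
      under eq_bigr => l _ do rewrite h.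
      rewrite (bigD1 j) //= eqxx mulr1n big1 ?addr0 // => l lj.
      by rewrite eq_sym (negPf lj) mulr0n rmorph0 mul0r.
    by apply: (wi_sum wQ) => i _; apply: (wiM wQ).
  rewrite -[f _]mulr1 -[X in _ * X](subrK (\sum_j f (u j) * e j)) mulrDr.
  apply: (wiD wQ); first exact: (wiM wQ).
  rewrite mulr_sumr; apply: (wi_sum wQ) => j _.
  by rewrite mulrCA; apply: (wiM wQ).
(* As x is in J, [N] is the identity modulo J, so its determinant is both 0 and 1 in the
   quotient. *)
have dJ : \det N \in J by apply: PJ.
have := dJ; rewrite -(qproj_eq0 hJ) -det_map_mx.
have -> : map_mx (qproj hJ) N = 1%:M.
  apply/matrixP => i j; rewrite !mxE rmorphB rmorphM /= rmorph_nat.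
  have /eqP -> : qproj hJ x == 0 by rewrite qproj_eq0.
  by rewrite mul0r subr0.
by rewrite det1 oner_eq0.
Qed.

End FiniteExtension.

(** * Algebraic dependence in finite algebras over a polynomial ring *)

Section AlgebraicDependence.
Variables (k : fieldType) (d : nat) (B : comNzRingType).
Variables (iota : {rmorphism {mpoly k[d]} -> B}) (q : nat) (e : 'I_q -> B).
Hypothesis span : forall b, exists a : 'I_q -> {mpoly k[d]}, b = \sum_j iota (a j) * e j.

(** [msize] is the degree plus one: the coordinates have degree at most D. *)
Let bounded D b := exists a : 'I_q -> {mpoly k[d]},
  b = \sum_j iota (a j) * e j /\ forall j, (msize (a j) <= D.+1)%N.

(** A dimension count. The (M + 1)^n monomials in f with exponents at most M have coordinates of
    degree at most D, with D linear in M, so these coordinates live in a space of dimension at most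
    q (D + 1)^d. For d < n and M large this forces a linear dependence. *)
Lemma alg_dependent n (f : 'I_n -> B) : (d < n)%N ->
  exists2 F : {mpoly k[n]}, F != 0 & mmap (iota \o @mpolyC d k) f F = 0.
Proof.
move=> dn; have [T hT] := choice (fun ij : 'I_n * 'I_q => span (f ij.1 * e ij.2)).
have [u hu] := span 1.
(* Multiplying by some f_i raises the degree of the coordinates by at most [E], which also bounds
   the degrees for 1. *)
pose E := ((\max_ij \max_j msize (T ij j)) + \max_j msize (u j)).+1%N.
have TE ij j : (msize (T ij j) < E)%N.
  rewrite ltnS.
  apply: leq_trans (leq_addr _ _).
  by apply: leq_trans (leq_bigmax ij); exact: (leq_bigmax j).
have uE j : (msize (u j) <= E)%N.
  by apply: leqW; apply: leq_trans (leq_addl _ _); exact: (leq_bigmax j).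
have step D b i : bounded D b -> bounded (D + E) (f i * b).
  move=> [a [-> ha]]; exists (fun l => \sum_j a j * T (i, j) l); split.
    under [RHS]eq_bigr => l _ do rewrite rmorph_sum mulr_suml.
    rewrite exchange_big mulr_sumr; apply: eq_bigr => j _ /=.
    rewrite mulrCA (hT (i, j)) mulr_sumr; apply: eq_bigr => l _.
    by rewrite rmorphM mulrA.
  move=> l; apply: leq_trans (msize_sum _ _ _) _; apply/bigmax_leqP => j _.
  apply: leq_trans (msizeM_le _ _) _.
  by have := ha j; have := TE (i, j) l; clearbody E; clear -E; move: (msize _) (msize _) E => x y E'; lia.
have stepX D b i l : bounded D b -> bounded (D + E * l) (f i ^+ l * b).
  move=> h; elim: l => [|l IH]; first by rewrite muln0 addn0 mul1r.
  by rewrite exprS -mulrA mulnSr addnA; exact: step.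
have stepP (m : 'X_{1..n}) : bounded (E + E * mdeg m) (mmap1 f m).
  rewrite mdegE big_distrr /= /mmap1 -[X in bounded _ X]mulr1.
  elim: (index_enum _) => [|i r IH].
    rewrite !big_nil mul1r addn0; exists u; split=> // j.
    by apply: leq_trans (uE j) _.
  by rewrite !big_cons addnCA addnC -mulrA; apply: stepX.
(* With these choices D + 1 <= c (M + 1) and q c^d = M, so q (D + 1)^d <= M (M + 1)^d < (M + 1)^(d +
   1). *)
pose c := (E.+1 + E * n)%N.
pose M := (q * c ^ d)%N.
pose D := (E + E * (n * M))%N.
pose rT : finType := {ffun 'I_n -> 'I_M.+1}.
pose cT : finType := ('I_q * {ffun 'I_d -> 'I_D.+1})%type.
have card_lt : (#|cT| < #|rT|)%N.
  rewrite card_prod !card_ffun !card_ord.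
  apply: (@leq_ltn_trans (q * (c * M.+1) ^ d)).
    rewrite leq_mul2l; apply/orP; right.
    have [->|d0] := posnP d; first by rewrite !expn0.
    by rewrite leq_exp2r // /c /D; clearbody E M; clear -E M; nia.
  apply: (@leq_trans (M.+1 ^ d.+1)); last by rewrite leq_pexp2l.
  by rewrite expnMn mulnA -/M [(_ ^ _.+1)%N]expnS ltn_pmul2r ?expn_gt0.
pose mon (al : rT) : 'X_{1..n} := [multinom nat_of_ord (al i) | i < n].
have mon_inj : injective mon.
  move=> a b /mnmP h; apply/ffunP => i; apply: val_inj.
  by have := h i; rewrite !mnmE.
have monD al : (E + E * mdeg (mon al) <= D)%N.
  rewrite leq_add2l leq_mul2l mdegE; apply/orP; right.
  apply: (@leq_trans (\sum_(i < n) M)%N); last by rewrite sum_nat_const card_ord.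
  by apply: leq_sum => i _; rewrite mnmE -ltnS ltn_ord.
have [p hp] := choice (fun al : rT => stepP (mon al)).
pose c1 (x : cT) : 'I_q := x.1.
pose c2 (x : cT) : 'X_{1..d} := [multinom nat_of_ord ((x.2 : {ffun 'I_d -> 'I_D.+1}) l) | l < d].
(* One row per monomial in f, one column per generator and exponent: [V] has more rows than columns,
   and a nonzero vector of its left kernel gives the coefficients of the relation. *)
pose V : 'M[k]_(#|rT|, #|cT|) := \matrix_(i, j)
  (p (enum_val i) (c1 (enum_val j)))@_(c2 (enum_val j)).
have : kermx V != 0.
  rewrite -mxrank_eq0 mxrank_ker -lt0n subn_gt0.
  by apply: leq_ltn_trans (rank_leq_col V) card_lt.
case/matrix0Pn => i0 [j0 hv].
pose v al := kermx V i0 (enum_rank al).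
have hV al2 : \sum_al v al * (p al (c1 al2))@_(c2 al2) = 0.
  have := mulmx_ker V => /matrixP/(_ i0 (enum_rank (al2 : cT))); rewrite [X in X = _]mxE [RHS]mxE => h.
  rewrite -[RHS]h (reindex (@enum_rank rT)) /=; last first.
    by exists enum_val => ? _; rewrite ?enum_rankK ?enum_valK.
  by apply: eq_bigr => al _; rewrite [V _ _]mxE !enum_rankK.
exists (\sum_al v al *: 'X_[mon al]).
  apply/negP => /eqP/mpolyP/(_ (mon (enum_val j0))).
  rewrite raddf_sum /= (bigD1 (enum_val j0)) //= mcoeffZ mcoeffX eqxx mulr1.
  rewrite big1 => [|al ne].
    by rewrite mcoeff0 addr0 /v enum_valK => h; rewrite h eqxx in hv.
  by rewrite mcoeffZ mcoeffX (inj_eq mon_inj) (negPf ne) mulr0.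
rewrite raddf_sum /=.
under eq_bigr => al _ do rewrite mmapZ mmapX (proj1 (hp al)) mulr_sumr.
rewrite exchange_big big1 //= => j _.
under eq_bigr => al _ do rewrite mulrA -rmorphM.
rewrite -mulr_suml -rmorph_sum /=; set S := \sum_al _.
suff -> : S = 0 by rewrite rmorph0 mul0r.
apply/mpolyP => m; rewrite mcoeff0 raddf_sum /=.
under eq_bigr => al _ do rewrite mul_mpolyC mcoeffZ.
have [hm|hm] := leqP (mdeg m) D; last first.
  rewrite big1 // => al _; rewrite memN_msupp_eq0 ?mulr0 // msize_mdeg_ge //.
  by apply: leq_trans hm; apply: leq_trans (proj2 (hp al) j) _; rewrite ltnS monD.
have hmi (i : 'I_d) : (m i < D.+1)%N.
  by rewrite ltnS; apply: leq_trans hm; rewrite mdegE (bigD1 i) //= leq_addr.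
have := hV (j, [ffun i => Ordinal (hmi i)]) => /=.
have -> // : c2 (j, [ffun i => Ordinal (hmi i)]) = m.
by apply/mnmP => i; rewrite mnmE ffunE.
Qed.

End AlgebraicDependence.

(** * Noether normalization *)

Section Normalization.
Variables (k : fieldType) (hk : [pchar k] =i pred0).

(** In characteristic zero the images of the natural numbers are pairwise distinct, so k has more
    elements than p has roots. *)
Lemma poly_nonroot (p : {poly k}) : p != 0 -> exists x, p.[x] != 0.
Proof.
move=> p0; apply: contrapT => h.
pose s := [seq (i%:R : k) | i <- iota 0 (size p)].
have : (size s < size p)%N.
  apply: max_poly_roots => //.
    by apply/allP => x _; apply: contraT => nx; case: h; exists x.
  rewrite map_inj_in_uniq ?iota_uniq // => i j _ _ /eqP.
  wlog ij : i j / (i <= j)%N => [H|].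
    by have [/H h1 /h1|/ltnW/H h1] := leqP i j; rewrite // eq_sym => /h1.
  rewrite eq_sym -subr_eq0 -natrB // ((pcharf0P k).1 hk) subn_eq0 => ji.
  by apply/anti_leq/andP.
by rewrite size_map size_iota ltnn.
Qed.

Lemma mpoly_nonroot n (p : {mpoly k[n]}) : p != 0 -> exists v, p.@[v] != 0.
Proof.
elim: n p => [|n IH] p p0.
  exists (fun=> 0); rewrite (nvar0_mpolyC p) mevalC.
  by apply: contraNneq p0 => h; rewrite (nvar0_mpolyC p) h mpolyC0.
have m0 : munim k n p != 0 by rewrite -(rmorph0 (munim k n)) (can_eq (@muniK k n)).
have [v hv] : exists v, (lead_coef (munim k n p)).@[v] != 0.
  by apply: IH; rewrite lead_coef_eq0.
have /poly_nonroot[x hx] : map_poly (meval v) (munim k n p) != 0.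
  apply: contraNneq hv => h.
  have : (map_poly (meval v) (munim k n p))`_(size (munim k n p)).-1 = 0 by rewrite h coef0.
  by rewrite coef_map /= => <-.
pose w i := if unlift ord_max i is Some j then v j else x.
exists w; suff -> : p.@[w] = (map_poly (meval v) (munim k n p)).[x] by [].
pose g : {rmorphism {poly {mpoly k[n]}} -> k} :=
  horner_morph (fun y => mulrC x (meval v y)).
apply: (@eq_rmorph_mpoly k n.+1 k (meval w) (g \o munim k n)) => [a|i] /=.
  by rewrite mevalC muniC /g /= horner_morphC /= mevalC.
rewrite mevalXU; elim/ord_max_widen: i => [|i].
  by have /= -> := muni_max k n; rewrite /g /= horner_morphX /w unlift_none.
have /= -> := muni_widen k i; rewrite /g /= horner_morphC /= mevalXU /w.
have -> : widen_ord (leqnSn n) i = lift ord_max i.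
  by apply: val_inj; rewrite /= /bump leqNgt ltn_ord.
by rewrite liftK.
Qed.

(** Serves to read off the top coefficient of a monomial after a linear change of variables. *)
Lemma coef_prod_linear (R : comNzRingType) (I : Type) (r : seq I) (p : I -> {poly R})
    (m : I -> nat) : (forall i, size (p i) <= 2)%N ->
  let P := \prod_(i <- r) p i ^+ m i in let d := (\sum_(i <- r) m i)%N in
  (size P <= d.+1)%N /\ P`_d = \prod_(i <- r) (p i)`_1 ^+ m i.
Proof.
move=> hp; have mulP (a b : {poly R}) i j : (size a <= i.+1)%N -> (size b <= j.+1)%N ->
    (size (a * b)%R <= (i + j).+1)%N /\ (a * b)`_(i + j) = a`_i * b`_j.
  move=> ha hb; split.
    apply: leq_trans (size_polyMleq _ _) _.
    by move: (size a) (size b) ha hb => x y; lia.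
  have lt : (i < (i + j).+1)%N by rewrite ltnS leq_addr.
  rewrite coefM (bigD1 (Ordinal lt)) //= addKn big1 ?addr0 // => l.
  rewrite -val_eqE /= => li; have [lt_li|ge_li] := ltnP l i.
    by rewrite (nth_default _ (leq_trans hb _)) ?mulr0 //; move: (nat_of_ord l) lt_li; lia.
  by rewrite nth_default ?mul0r // (leq_trans ha) // ltn_neqAle eq_sym li.
have expP (a : {poly R}) i : (size a <= 2)%N ->
    (size (a ^+ i)%R <= i.+1)%N /\ (a ^+ i)`_i = a`_1 ^+ i.
  move=> ha; elim: i => [|i [IH1 IH2]]; first by rewrite expr0 size_poly1 coefC.
  by have [] := mulP _ _ 1%N i ha IH1; rewrite -exprS add1n IH2 -exprS.
elim: r => [|i r [IH1 IH2]] /=; first by rewrite !big_nil size_poly1 coefC.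
rewrite !big_cons; have [h1 h2] := expP (p i) (m i) (hp i).
by have [h3 h4] := mulP _ _ _ _ h1 IH1; rewrite h4 h2 IH2.
Qed.

(** Let y be the last variable, D the degree of f and g its homogeneous part of degree D. The
    substitution x_i -> x_i + v_i y, y -> v_y y gives y^D the constant coefficient g(v), so f
    becomes monic up to a scalar as soon as g(v) is nonzero. *)
Lemma exists_monic_change n (f : {mpoly k[n.+1]}) : f != 0 ->
  exists (phi : {rmorphism {mpoly k[n.+1]} -> {poly {mpoly k[n]}}})
         (psi : {rmorphism {poly {mpoly k[n]}} -> {mpoly k[n.+1]}}) a,
  [/\ cancel phi psi, cancel psi phi, (forall c, psi (c%:MP)%:P = c%:MP)
    & a%:MP != 0 :> {mpoly k[n]} /\ a%:MP%:P * phi f \is monic].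
Proof.
move=> f0; pose D := (msize f).-1.
pose g := \sum_(m <- msupp f | mdeg m == D) f@_m *: 'X_[k, m].
have fD : (mdeg (mlead f)).+1 = msize f by rewrite mlead_deg.
have g0 : g != 0.
  apply/negP => /eqP/mpolyP/(_ (mlead f)); rewrite mcoeff0 raddf_sum /=.
  rewrite -big_filter (bigD1_seq (mlead f)) ?filter_uniq ?msupp_uniq //=; last first.
    by rewrite mem_filter mlead_supp // /D -fD eqxx.
  rewrite mcoeffZ mcoeffX eqxx mulr1 big1 ?addr0.
    by move/eqP; rewrite mleadc_eq0 (negPf f0).
  by move=> m ne; rewrite mcoeffZ mcoeffX (negPf ne) mulr0.
(* The extra factor makes the last coordinate of v nonzero, so that the substitution is
   invertible. *)
have [v hv] : exists v, (g * 'X_ord_max).@[v] != 0.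
  apply: mpoly_nonroot; rewrite mulf_neq0 // -msupp_eq0 msuppX //.
move: hv; rewrite mevalM mevalXU mulf_eq0 negb_or => /andP[gv cv].
set c := v ord_max in cv.
pose h (i : 'I_n.+1) : {mpoly k[n.+1]} :=
  if i == ord_max then c *: 'X_ord_max else 'X_i + v i *: 'X_ord_max.
pose h' (i : 'I_n.+1) : {mpoly k[n.+1]} :=
  if i == ord_max then c^-1 *: 'X_ord_max else 'X_i - (v i / c) *: 'X_ord_max.
have subst (g1 : 'I_n.+1 -> {mpoly k[n.+1]}) : exists tau : {rmorphism {mpoly k[n.+1]} -> {mpoly k[n.+1]}},
    (forall a, tau a%:MP = a%:MP) /\ (forall i, tau 'X_i = g1 i).
  exists (mmap (@mpolyC _ _) g1); split=> [a|i] /=; first by rewrite mmapC.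
  by rewrite mmapX mmap1U.
have [tau [tauC tauX]] := subst h; have [tau' [tauC' tauX']] := subst h'.
have tauK : cancel tau tau'.
  apply: (@eq_rmorph_mpoly k n.+1 _ (tau' \o tau) idfun) => [a|i] /=.
    by rewrite tauC tauC'.
  rewrite tauX /h; case: eqVneq => [->|ne].
    by rewrite -mul_mpolyC rmorphM tauC' tauX' /h' eqxx mul_mpolyC scalerA mulfV // scale1r.
  rewrite -mul_mpolyC rmorphD rmorphM tauC' !tauX' /h' eqxx (negPf ne).
  by rewrite mul_mpolyC scalerA subrK.
have tauK' : cancel tau' tau.
  apply: (@eq_rmorph_mpoly k n.+1 _ (tau \o tau') idfun) => [a|i] /=.
    by rewrite tauC' tauC.
  rewrite tauX' /h'; case: eqVneq => [->|ne].
    by rewrite -mul_mpolyC rmorphM tauC tauX /h eqxx mul_mpolyC scalerA mulVf // scale1r.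
  rewrite -mul_mpolyC rmorphB rmorphM tauC !tauX /h eqxx (negPf ne).
  by rewrite mul_mpolyC scalerA divfK // addrK.
pose phi : {rmorphism {mpoly k[n.+1]} -> {poly {mpoly k[n]}}} := munim k n \o tau.
pose psi : {rmorphism {poly {mpoly k[n]}} -> {mpoly k[n.+1]}} := tau' \o multim k n.
exists phi, psi, (g.@[v])^-1; split.
- by move=> p; rewrite /phi /psi /= [X in tau' X](@muniK k n) tauK.
- by move=> p; rewrite /phi /psi /= tauK'; exact: (@multiK k n).
- by move=> a; rewrite /psi /= [X in tau' X]multim_C mwidenC tauC'.
have phiX i : (size (phi 'X_i) <= 2)%N /\ (phi 'X_i)`_1 = (v i)%:MP.
  have muZ a : munim k n (a *: 'X_ord_max) = a%:MP%:P * 'X.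
    by rewrite -mul_mpolyC rmorphM; have /= -> := muni_max k n; rewrite muniC.
  have -> : phi 'X_i = munim k n (h i) by rewrite -tauX.
  rewrite /h; case: eqVneq => [->|].
    by rewrite muZ coefCM coefX mulr1 mul_polyC (leq_trans (size_scale_leq _ _)) ?size_polyX.
  rewrite rmorphD muZ; elim/ord_max_widen: i => [|i _]; first by rewrite eqxx.
  rewrite muni_widen coefD coefC coefCM coefX add0r mulr1; split=> //.
  apply: leq_trans (size_polyD _ _) _; rewrite geq_max mul_polyC.
  rewrite (leq_trans (size_polyC_leq1 _)) // (leq_trans (size_scale_leq _ _)) //.
  by rewrite size_polyX.
have phiM m : (size (phi 'X_[m]) <= (mdeg m).+1)%N /\
    (phi 'X_[m])`_(mdeg m) = (('X_[k, m]).@[v])%:MP.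
  have -> : phi 'X_[m] = \prod_i phi 'X_i ^+ m i.
    by rewrite mpolyXE_id rmorph_prod; apply: eq_bigr => i _; rewrite rmorphXn.
  rewrite mdegE mevalX.
  have [|h1 ->] := @coef_prod_linear _ _ (index_enum 'I_n.+1) (fun i => phi 'X_i) m.
    by move=> i; case: (phiX i).
  split=> //; rewrite rmorph_prod; apply: eq_bigr => i _.
  by rewrite rmorphXn (proj2 (phiX i)).
have phiE : phi f = \sum_(m <- msupp f) (f@_m)%:MP%:P * phi 'X_[m].
  rewrite {1}(mpolyE f) rmorph_sum; apply: eq_bigr => m _.
  by rewrite -mul_mpolyC rmorphM {1}/phi /= tauC muniC.
have coefD' : (phi f)`_D = (g.@[v])%:MP.
  rewrite phiE coef_sum /g (raddf_sum (meval v)) (raddf_sum (@mpolyC n k)) /=.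
  rewrite [RHS]big_mkcond /= !big_seq.
  apply: eq_bigr => m hm; rewrite coefCM.
  case: eqVneq => [<-|ne]; first by rewrite (proj2 (phiM m)) -rmorphM mevalZ.
  have : (mdeg m < msize f)%N by exact: msize_mdeg_lt.
  rewrite -fD ltnS leq_eqVlt /D -fD /= => /orP[h2|h2].
    by rewrite /D -fD /= in ne; rewrite h2 in ne.
  by rewrite nth_default ?mulr0 //; apply: leq_trans (proj1 (phiM m)) h2.
have size_phi : (size (phi f) <= D.+1)%N.
  rewrite phiE; apply: leq_trans (size_sum _ _ _) _; apply/bigmax_leqP_seq => m hm _.
  rewrite mul_polyC; apply: leq_trans (size_scale_leq _ _) _.
  apply: leq_trans (proj1 (phiM m)) _.
  by rewrite ltnS -ltnS /D -fD /= fD; exact: msize_mdeg_lt.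
split; first by rewrite mpolyC_eq0 invr_eq0.
have sz : size (phi f) = D.+1.
  apply/anti_leq; rewrite size_phi /= ltnNge; apply/negP => h2.
  by move: gv; rewrite -(mpolyC_eq0 n) -coefD' nth_default ?eqxx.
have a0 : ((g.@[v])^-1)%:MP != 0 :> {mpoly k[n]} by rewrite mpolyC_eq0 invr_eq0.
rewrite mul_polyC monicE lead_coefZ lead_coefE sz /= coefD' -rmorphM mulVf //.
Qed.

(* Noether normalization, with the chain of contractions of P producing a
   regular sequence. *)
Lemma noether_normalization n (P : {pred {mpoly k[n]}}) : idealr_closed P ->
  exists e (s : seq {mpoly k[n]}) (w : 'I_e -> {mpoly k[n]}),
  [/\ weakly_regular s, {subset s <= P}, (size s + e)%N = n,
      forall F : {mpoly k[e]}, mmap (@mpolyC n k) w F \in P -> F = 0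
    & maximal_ideal P -> e = 0%N].
Proof.
elim: n P => [|n IH] P hP.
  exists 0%N, [::], (fun=> 0); split=> // F; rewrite (nvar0_mpolyC F) mmapC => h.
  apply/eqP; rewrite mpolyC_eq0; apply: contraT => c0; have [_ P1 _] := hP.
  case/negP: P1; have := wiM (idealr_closed_weak hP) ((F@_0)^-1)%:MP h.
  by rewrite -mpolyCM mulVf.
have wP := idealr_closed_weak hP; have [_ P1 _] := hP.
have [[f [fP f0]]|nf] := pselect (exists f, f \in P /\ f != 0); last first.
  have PE p : p \in P -> p = 0.
    by move=> hp; apply/eqP; apply: contraT => p0; case: nf; exists p.
  exists n.+1, [::], (fun i => 'X_i); split=> //.
    move=> F; have -> : mmap (@mpolyC _ k) (fun i => 'X_i) F = F; last exact: PE.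
    apply: (@eq_rmorph_mpoly k n.+1 _ (mmap (@mpolyC _ k) (fun i => 'X_i)) idfun) => [c|i] /=.
      by rewrite mmapC.
    by rewrite mmapX mmap1U.
  (* The zero ideal is not maximal: the polynomials vanishing at the origin form a larger proper
     ideal. *)
  move=> [_ maxP]; pose J : {pred {mpoly k[n.+1]}} := fun p => p.@[fun=> 0] == 0.
  have JE p : (p \in J) = (p.@[fun=> 0] == 0) by [].
  have hJ : idealr_closed J.
    split; rewrite ?JE ?meval0 ?meval1 ?oner_eq0 // => a u v.
    by rewrite !JE mevalD mevalM => /eqP -> /eqP ->; rewrite mulr0 addr0.
  have : 'X_ord_max \in P.
    apply: (maxP J hJ) => [p /PE ->|]; first by rewrite JE meval0.
    by rewrite JE mevalXU.
  by move/PE/eqP; rewrite -msupp_eq0 msuppX.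
have [phi [psi [a [phiK psiK psiC [a0 mon]]]]] := exists_monic_change f0.
set fh := a%:MP%:P * phi f in mon.
have fhP : psi fh \in P by rewrite rmorphM phiK; apply: (wiM wP).
pose Q : {pred {poly {mpoly k[n]}}} := fun p => psi p \in P.
have QE p : (p \in Q) = (psi p \in P) by [].
have hQ : idealr_closed Q.
  split; rewrite ?QE ?rmorph0 ?rmorph1 ?(wi0 wP) // => b u v.
  by rewrite !QE rmorphD rmorphM => hu hv; exact: (wiD wP (wiM wP _ hu) hv).
have wQ := idealr_closed_weak hQ.
(* After the change of variables, P is contracted to the polynomials in one variable fewer; the
   monic element [fh] extends the sequence found there. *)
pose P' : {pred {mpoly k[n]}} := fun p => p%:P \in Q.
have P'E p : (p \in P') = (p%:P \in Q) by [].
have hP' : idealr_closed P'.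
  split; rewrite ?P'E ?(wi0 wQ) //; first by case: hQ.
  move=> b u v; rewrite !P'E => hu hv.
  have -> : (b * u + v)%:P = b%:P * u%:P + v%:P :> {poly {mpoly k[n]}}.
    by rewrite polyCD polyCM.
  exact: (wiD wQ (wiM wQ _ hu) hv).
have [e [s [w [rs sP' se hw maxe]]]] := IH P' hP'.
exists e, (map psi (rcons (map polyC s) fh)), (fun i => psi (w i)%:P); split.
- by apply: (weakly_regular_iso psiK phiK); apply: weakly_regular_monic.
- move=> _ /mapP[p hp ->]; move: hp; rewrite mem_rcons inE => /orP[/eqP -> //|].
  by case/mapP => p' /sP' hp' ->.
- by rewrite size_map size_rcons size_map addSn se.
- move=> F; have e1 := @eq_rmorph_mpoly k e _ (mmap (@mpolyC _ k) (fun i => psi (w i)%:P))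
    (psi \o (polyC \o mmap (@mpolyC _ k) w)).
  rewrite e1 /= => [h|c|i]; first exact: hw.
    by rewrite !mmapC psiC.
  by rewrite !mmapX !mmap1U.
move=> maxP; apply: maxe.
have maxQ : maximal_ideal Q.
  split=> // J hJ QJ; pose J' : {pred {mpoly k[n.+1]}} := fun p => phi p \in J.
  have J'E p : (p \in J') = (phi p \in J) by [].
  have wJ := idealr_closed_weak hJ.
  have hJ' : idealr_closed J'.
    split; rewrite ?J'E ?rmorph0 ?rmorph1 ?(wi0 wJ) //; first by case: hJ.
    move=> b u v.
    by rewrite !J'E rmorphD rmorphM => hu hv; exact: (wiD wJ (wiM wJ _ hu) hv).
  move=> p hp; rewrite QE; apply: (proj2 maxP J' hJ'); last by rewrite J'E psiK.
  by move=> q hq; rewrite J'E; apply: QJ; rewrite QE phiK.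
pose q := (size fh).-1.
(* Division by [fh] shows that the powers of X below its degree span modulo Q, so the maximal ideal
   Q has a maximal contraction. *)
have szfh : size fh = q.+1 by rewrite /q prednK // size_poly_gt0 monic_neq0.
apply: (@maximal_contraction _ _ polyC q (fun j => 'X^j) Q) => // b.
exists (fun j => (Pdiv.Ring.rmodp b fh)`_j).
rewrite {1}(Pdiv.RingMonic.rdivp_eq mon b) -addrA.
have eS : Pdiv.Ring.rmodp b fh = \sum_(j < q) ((Pdiv.Ring.rmodp b fh)`_j)%:P * 'X^j.
  rewrite -[LHS](@coefK _ _) (poly_def _ _) /=.
  have := Pdiv.Ring.ltn_rmodp b fh; rewrite monic_neq0 // szfh ltnS => h.
  rewrite (big_ord_widen q (fun i => (Pdiv.Ring.rmodp b fh)`_i *: 'X^i) h) big_mkcond.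
  apply: eq_bigr => i _; rewrite mul_polyC; case: ltnP => // h'.
  by rewrite nth_default // scale0r.
rewrite -[X in _ + (_ - X)]eS subrr addr0; exact: (wiM wQ _ fhP).
Qed.

End Normalization.

(** * Quotients that are free over a polynomial ring *)

Lemma noetherian_mpoly (k : fieldType) n : noetherian {mpoly k[n]}.
Proof.
elim: n => [|n IH].
  apply: (@noetherian_surj _ _ (@mpolyC 0 k)) (@noetherian_field k) => p.
  by exists p@_0; exact: nvar0_mpolyC.
apply: (@noetherian_surj _ _ (multim k n)) (noetherian_poly IH) => p.
by exists (munim k n p); rewrite muniK.
Qed.

Section FreeRegular.
Variables (A B : comNzRingType) (f : {rmorphism A -> B}) (q : nat) (e : 'I_q -> B).
Hypothesis span : forall b, exists a : 'I_q -> A, b = \sum_j f (a j) * e j.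
Hypothesis indep : forall a : 'I_q -> A, \sum_j f (a j) * e j = 0 -> forall j, a j = 0.

Lemma free_mem_seq_ideal (s : seq A) (a : 'I_q -> A) :
  \sum_j f (a j) * e j \in seq_ideal (map f s) <-> forall j, a j \in seq_ideal s.
Proof.
split=> [/seq_idealP[c hc] j|h]; last first.
  apply: (wi_sum (seq_ideal_weak _)) => j _; rewrite mulrC.
  apply: (wiM (seq_ideal_weak _)); have /seq_idealP[c ->] := h j.
  rewrite rmorph_sum; apply: (wi_sum (seq_ideal_weak _)) => i _.
  rewrite rmorphM; apply: (wiM (seq_ideal_weak _)).
  by apply: mem_seq_ideal; rewrite map_f ?mem_nth.
have [b hb] := choice (fun i => span (c i)).
have /eqP : a j - \sum_(i < size s) b i j * s`_i = 0.
  move: j; apply: indep; under eq_bigr => j _ do rewrite rmorphB mulrBl.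
  rewrite sumrB hc; apply/eqP; rewrite subr_eq0 size_map; apply/eqP.
  under [RHS]eq_bigr => j _ do rewrite rmorph_sum mulr_suml.
  rewrite exchange_big; apply: eq_bigr => i _ /=.
  rewrite (nth_map 0) // hb mulr_suml; apply: eq_bigr => j _.
  by rewrite rmorphM mulrAC.
rewrite subr_eq0 => /eqP ->; apply: (wi_sum (seq_ideal_weak _)) => i _.
by apply: (wiM (seq_ideal_weak _)); rewrite mem_seq_ideal ?mem_nth.
Qed.

(** Over a basis, membership in an ideal generated by elements of A is tested on coordinates, and
    multiplication by elements of A acts on coordinates. *)
Lemma free_weakly_regular (s : seq A) : weakly_regular s -> weakly_regular (map f s).
Proof.
move=> hs i; rewrite size_map => hi x; rewrite -map_take (nth_map 0) //.
have [a ->] := span x; rewrite mulr_sumr.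
under eq_bigr => j _ do rewrite mulrA -rmorphM.
move/(@free_mem_seq_ideal (take i s) (fun j => s`_i * a j)) => h.
by apply/free_mem_seq_ideal => j; apply: hs.
Qed.

End FreeRegular.

Section FreeQuotient.
Variables (k : fieldType) (hk : [pchar k] =i pred0) (n d q : nat).
Variables (I : {pred {mpoly k[n]}}) (hI : idealr_closed I).
Let B := quotient_ring hI.
Variables (iota : {rmorphism {mpoly k[d]} -> B}) (e : 'I_q -> B).
Hypothesis iotaC : forall c, iota c%:MP = qproj hI c%:MP.
Hypothesis span : forall b, exists a : 'I_q -> {mpoly k[d]}, b = \sum_j iota (a j) * e j.
Hypothesis indep : forall a : 'I_q -> {mpoly k[d]},
  \sum_j iota (a j) * e j = 0 -> forall j, a j = 0.

Let chain_quotient (Q : {pred B}) l : prime_chain_below Q l -> (l <= d)%N.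
Proof.
apply: (@prime_chain_bound _ _ (iota \o @mpolyC d k)) => f.
exact: (@alg_dependent _ _ _ iota q e).
Qed.

Let chain_mpoly (P : {pred {mpoly k[n]}}) l : prime_chain_below P l -> (l <= n)%N.
Proof.
apply: (@prime_chain_bound _ _ (idfun \o @mpolyC n k)) => f.
apply: (@alg_dependent _ _ _ idfun 1 (fun=> 1)) => // b.
by exists (fun=> b); rewrite big_ord1 mulr1.
Qed.

(** The contraction of Q to the polynomial ring is maximal, so normalization finds in it a regular
    sequence of full length d, which stays regular in the free algebra B. *)
Let regular_in_maximal (Q : {pred B}) : maximal_ideal Q ->
  exists s : seq B, [/\ weakly_regular s, {subset s <= Q} & size s = d].
Proof.
move=> maxQ; have [hQ _] := maxQ; have wQ := idealr_closed_weak hQ.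
have maxP : maximal_ideal (fun a => iota a \in Q).
  apply: (@maximal_contraction _ _ iota q e Q) maxQ => b.
  by have [a ->] := span b; exists a; rewrite subrr (wi0 wQ).
have [e' [s [w [rs sP se _ e0]]]] := noether_normalization hk (proj1 maxP).
exists (map iota s); split.
- exact: free_weakly_regular span indep _ rs.
- by move=> _ /mapP[a /sP ha ->].
- by move: se; rewrite size_map (e0 maxP) addn0.
Qed.

(** Depth and height of a maximal ideal are both d: a regular sequence of length d bounds them from
    below, and the length of chains of primes, to which regular sequences give rise, bounds them
    from above. *)
Lemma free_cohen_macaulay : cohen_macaulay B.
Proof.
split.
  apply: (@noetherian_surj _ _ (qproj hI)) (@noetherian_mpoly k n).
  exact: qproj_surj.
move=> Q maxQ; have [s [rs sQ szs]] := regular_in_maximal maxQ.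
have pQ := maximal_prime maxQ; have [hQ _] := maxQ; have [_ Q1 _] := hQ.
exists d; split.
- exists s; split=> //; split=> //; apply: contra Q1.
  exact: seq_ideal_min (idealr_closed_weak hQ) sQ _.
- move=> s' [rs' _] sQ'; apply: (@chain_quotient Q).
  exact: regular_chain.
- exists Q; split=> //; split; last exact: chain_quotient.
  by rewrite -szs; exact: regular_chain.
- move=> P h pP QP [_ hP]; apply: hP; rewrite -szs; apply: regular_chain => //.
  by move=> x /sQ /QP.
Qed.

Let preim (Q : {pred B}) : {pred {mpoly k[n]}} := fun x => qproj hI x \in Q.

Let mem_preim Q x : (x \in preim Q) = (qproj hI x \in Q). Proof. by []. Qed.

Let prime_preim Q : prime_ideal Q -> prime_ideal (preim Q).
Proof.
move=> [hQ pQ]; have wQ := idealr_closed_weak hQ; have [_ Q1 _] := hQ; split.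
  split; rewrite ?mem_preim ?rmorph0 ?rmorph1 ?(wi0 wQ) // => a u v.
  by rewrite !mem_preim rmorphD rmorphM => hu hv; exact: (wiD wQ (wiM wQ _ hu) hv).
by move=> u v; rewrite !mem_preim rmorphM; exact: pQ.
Qed.

(** Normalization of P gives a regular sequence in P and e' elements independent modulo P, hence
    modulo I. Algebraic dependence in the quotient forces e' <= d, so the sequence has length at
    least n - d. *)
Let long_chain (P : {pred {mpoly k[n]}}) : prime_ideal P -> {subset I <= P} ->
  exists2 l, (n <= l + d)%N & prime_chain_below P l.
Proof.
move=> pP IP.
have [e' [s [w [rs sP se hw _]]]] := noether_normalization hk (proj1 pP).
exists (size s); last exact: regular_chain.
rewrite -[X in (X <= _)%N]se leq_add2l leqNgt; apply/negP => lt.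
have [F F0 hF] := @alg_dependent _ _ _ iota q e span _ (fun i => qproj hI (w i)) lt.
case/eqP: F0; apply: hw; apply: IP; rewrite -(qproj_eq0 hI) -hF; apply/eqP.
have e1 := @eq_rmorph_mpoly k e' _ (qproj hI \o mmap (@mpolyC n k) w)
  (mmap (iota \o @mpolyC d k) (fun i => qproj hI (w i))).
apply: e1 => [c|i]; rewrite [LHS]/(qproj hI (mmap _ _ _)).
  by rewrite mmapC [RHS]mmapC /= iotaC.
by rewrite mmapX [RHS]mmapX !mmap1U.
Qed.

(** [long_chain] bounds heights from below. The bound is attained at the preimage of the bottom
    prime of a chain of length d in the quotient: a chain below it is prolonged by d steps, and
    chains in the polynomial ring have length at most n. *)
Lemma free_codim : codim I (n - d).
Proof.
have [Q maxQ _] : exists2 Q : {pred B}, maximal_ideal Q & {subset seq_ideal [::] <= Q}.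
  apply: exists_maximal; first exact: seq_ideal_weak.
  by rewrite seq_ideal_nil oner_eq0.
have [s [rs sQ szs]] := regular_in_maximal maxQ.
have [C [hC1 hC2 _]] := regular_chain rs sQ (maximal_prime maxQ).
rewrite szs in hC1 hC2.
have up P' l i : P' =i preim (C 0%N) -> (i <= d)%N -> prime_chain_below P' l ->
    prime_chain_below (preim (C i)) (l + i).
  move=> eP; elim: i => [|i IH] hi h.
    by rewrite addn0; case: h => D [h1 h2 h3]; exists D; split=> // x; rewrite h3.
  rewrite addnS; apply: (prime_chain_rcons (IH (ltnW hi) h)).
    by apply/prime_preim/hC1.
  have [h1 h2] := hC2 _ hi; split=> [x|h3]; first exact: h1.
  by apply: h2 => y; have [x ->] := qproj_surj y; exact: h3.
have p0 : prime_ideal (preim (C 0%N)) by apply/prime_preim/hC1.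
have I0 : {subset I <= preim (C 0%N)}.
  move=> x; rewrite -(qproj_eq0 hI) mem_preim => /eqP ->.
  by have [/idealr_closed_weak wC _] := hC1 0%N isT; exact: wi0 wC.
have bnd l : prime_chain_below (preim (C 0%N)) l -> (l + d <= n)%N.
  by move=> h; apply: chain_mpoly (up _ _ _ _ (leqnn d) h).
split.
  exists (preim (C 0%N)); split=> //; split; last first.
    by move=> l /bnd h; rewrite leq_subRL ?(leq_trans (leq_addl _ _) h) // addnC.
  have [l h1 h2] := long_chain p0 I0.
  have -> // : (n - d)%N = l by have := bnd l h2; lia.
move=> P h' pP IP [_ hP]; have [l h1 h2] := long_chain pP IP.
by rewrite leq_subLR addnC; apply: leq_trans h1 _; rewrite leq_add2r hP.
Qed.

End FreeQuotient.

(** * Hankel determinants *)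

(** A minor of an infinite Hankel matrix, with rows a and columns c. These are total functions for
    ease of shifting; only their values below t matter. *)
Definition hankel_det (R : comNzRingType) (x : nat -> R) t (a c : nat -> nat) : R :=
  \det (\matrix_(i < t, j < t) x (a i + c j)%N).

Lemma eq_hankel_det (R : comNzRingType) (x : nat -> R) t (a a' c c' : nat -> nat) :
  (forall i, (i < t)%N -> a i = a' i) -> (forall i, (i < t)%N -> c i = c' i) ->
  hankel_det x t a c = hankel_det x t a' c'.
Proof.
by move=> ha hc; congr (\det _); apply/matrixP => i j; rewrite !mxE ha ?hc.
Qed.

(** Expansion along the last row of a determinant whose last row repeats row rho. *)
Lemma hankel_relation (R : comNzRingType) (x : nat -> R) t rho (d : nat -> nat) :
  (rho < t)%N ->
  \sum_(l < t.+1) (-1) ^+ (t + l) * (x (rho + d l)%N * hankel_det x t id (d \o bump l)) = 0.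
Proof.
move=> lt; pose M : 'M[R]_t.+1 :=
  \matrix_(i, j) x ((if i == ord_max then rho else i) + d j)%N.
have e0 : \det M = 0.
  have ne : widen_ord (leqnSn t) (Ordinal lt) != ord_max.
    by rewrite -val_eqE /= neq_ltn lt.
  apply: (determinant_alternate ne) => j; rewrite !mxE eqxx (negPf ne) //.
rewrite -[RHS]e0 (expand_det_row M ord_max); apply: eq_bigr => l _.
rewrite mxE eqxx mulrCA; congr (_ * _); rewrite /cofactor; congr (_ * _).
congr (\det _); apply/matrixP => i j; rewrite !mxE.
by rewrite eq_sym (negPf (neq_lift _ _)) lift_max.
Qed.

Definition increasing t (c : nat -> nat) := forall i j, (i < j < t)%N -> (c i < c j)%N.

Lemma increasing_geq t c i : increasing t c -> (i < t)%N -> (i <= c i)%N.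
Proof.
move=> hc; elim: i => // i IH hi; apply: leq_ltn_trans (IH (ltnW hi)) _.
by apply: hc; rewrite ltnSn.
Qed.

(** * The antidiagonal term has least weight *)

Section Rearrangement.
Variables (t : nat) (c : nat -> nat).
Hypothesis hc : increasing t c.

Lemma antitone_perm (s : 'S_t) :
  (forall i j : 'I_t, (i < j)%N -> (s j < s i)%N) -> s =1 @rev_ord t.
Proof.
move=> hs; pose f (i : 'I_t) := s (rev_ord i).
have fmono (i j : 'I_t) : (i < j)%N -> (f i < f j)%N.
  by move=> ij; apply: hs => /=; have := ltn_ord j; lia.
have fge m (i : 'I_t) : i = m :> nat -> (i <= f i)%N.
  elim: m i => [|m IH] i hi; first by rewrite hi.
  have hm : (m < t)%N by have := ltn_ord i; lia.
  have := IH (Ordinal hm) erefl; have := @fmono (Ordinal hm) i.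
  rewrite /= hi ltnSn => /(_ isT) h1 h2; exact: leq_ltn_trans h2 h1.
have sumE : (\sum_(i < t) f i = \sum_(i < t) i)%N.
  rewrite [RHS](reindex_inj (@perm_inj _ s)) [RHS](reindex_inj rev_ord_inj).
  by [].
have fE i : f i = i :> nat.
  apply/eqP; rewrite eqn_leq (fge i i erefl) andbT leqNgt; apply/negP => lt.
  move: sumE; rewrite (bigD1 i) // [RHS](bigD1 i) //=.
  have : (\sum_(j < t | j != i) j <= \sum_(j < t | j != i) f j)%N.
    by apply: leq_sum => j _; exact: fge erefl.
  move: lt => /=; set A := (\sum_(_ < t | _) _)%N; set B := (\sum_(_ < t | _) _)%N.
  by move: A B (nat_of_ord (f i)) (nat_of_ord i); clear; lia.
by move=> i; have := fE (rev_ord i); rewrite /f rev_ordK => e; exact: val_inj.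
Qed.

(** The weight of the term of the Leibniz expansion indexed by s, with x_i of weight i^2. *)
Definition perm_energy (s : 'S_t) := (\sum_(i < t) (i + c (s i)) ^ 2)%N.

(** The rearrangement inequality: exchanging the values at i < j when s i < s j strictly lowers the
    sum of squares, so a minimizer is order reversing, and there is only one such permutation. *)
Lemma perm_energy_min (s0 : 'S_t) : s0 =1 @rev_ord t ->
  forall s, s != s0 -> (perm_energy s0 < perm_energy s)%N.
Proof.
move=> es0.
have swap (s : 'S_t) (i j : 'I_t) : (i < j)%N -> (s i < s j)%N ->
    (perm_energy (tperm i j * s)%g < perm_energy s)%N.
  move=> ij sij; have ne : j != i by rewrite -val_eqE neq_ltn ij orbT.
  have hcc : (c (s i) < c (s j))%N by apply: hc; rewrite sij ltn_ord.
  rewrite /perm_energy (bigD1 i) // (bigD1 j) //= [X in (_ < X)%N](bigD1 i) //=.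
  rewrite [X in (_ < _ + X)%N](bigD1 j) //= !permM tpermL tpermR.
  have -> : (\sum_(l < t | (l != i) && (l != j)) (l + c ((tperm i j * s)%g l)) ^ 2 =
      \sum_(l < t | (l != i) && (l != j)) (l + c (s l)) ^ 2)%N.
    by apply: eq_bigr => l /andP[li lj]; rewrite permM tpermD // eq_sym.
  move: (\sum_(l < t | _) _)%N => S.
  by move: (nat_of_ord i) (nat_of_ord j) (c (s i)) (c (s j)) ij hcc; clear; nia.
have min_unique s : (forall s', perm_energy s <= perm_energy s')%N -> s = s0.
  move=> hmin; apply/permP => i; rewrite es0; move: i; apply: antitone_perm => i j ij.
  rewrite ltnNge leq_eqVlt; apply/negP => /orP[/eqP e|lt].
    by have := perm_inj (val_inj e) => e'; rewrite e' ltnn in ij.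
  by have := hmin (tperm i j * s)%g; rewrite leqNgt swap.
have [smin _ hmin] := @arg_minnP _ (1%g : 'S_t) xpredT perm_energy isT.
have e0 := min_unique smin (fun s' => hmin s' isT).
move=> s ne; rewrite ltnNge; apply: contraNN ne => le; apply/eqP/min_unique => s'.
by apply: leq_trans le _; rewrite -e0; exact: hmin.
Qed.

End Rearrangement.

Definition antidiag_energy t (c : nat -> nat) := (\sum_(i < t) (c i + (t.-1 - i)) ^ 2)%N.

(* Two consecutive terms of [hankel_relation], as functions of the removed
   column, differ by 2 (t-1-rho-l) (d_(l+1) - d_l). *)
Lemma antidiag_energy_bump t rho d j l : (rho + j)%N = t.-1 -> (j < t)%N ->
  increasing t.+1 d -> (l <= t)%N ->
  let T i := ((rho + d i) ^ 2 + antidiag_energy t (d \o bump i))%N in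
  T j.+1 = T j /\ ((l != j) && (l != j.+1) -> (T j < T l)%N).
Proof.
move=> erho jt hd lt T.
have step i : (i < t)%N -> (T i + 2 * i * (d i.+1 - d i) = T i.+1 + 2 * j * (d i.+1 - d i))%N.
  move=> it; rewrite /T /antidiag_energy (bigD1 (Ordinal it)) //=.
  rewrite [in RHS](bigD1 (Ordinal it)) //= /bump leqnn ltnn /=.
  have -> : (\sum_(i0 < t | i0 != Ordinal it) (d ((i < i0) + i0) + (t.-1 - i0)) ^ 2 =
     \sum_(i0 < t | i0 != Ordinal it) (d ((i <= i0) + i0) + (t.-1 - i0)) ^ 2)%N.
    apply: eq_bigr => i0; rewrite -val_eqE /= => ne.
    by rewrite [(i <= i0)%N]leq_eqVlt eq_sym (negPf ne).
  move: (\sum_(i0 < t | _) _)%N => S; rewrite add1n add0n.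
  have : (d i < d i.+1)%N by apply: hd; rewrite ltnSn ltnS.
  move: (d i) (d i.+1) => x y xy.
  have -> : (t.-1 - i = rho + j - i)%N by rewrite erho.
  have : (i <= rho + j)%N by lia.
  by move: xy; clear; nia.
have dlt i : (i < t)%N -> (0 < d i.+1 - d i)%N.
  by move=> it; rewrite subn_gt0; apply: hd; rewrite ltnSn ltnS.
have eqj : T j.+1 = T j by have := step j jt; lia.
split=> //; case/andP => lj lj1.
(* The energies decrease up to j, agree at j and j + 1, and increase afterwards. *)
have down i : (i < j)%N -> (T i.+1 < T i)%N.
  by move=> ij; have it := ltn_trans ij jt; have := step i it; have := dlt i it; nia.
have up i : (j < i < t)%N -> (T i < T i.+1)%N.
  by move=> /andP[ij it]; have := step i it; have := dlt i it; nia.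
case: (ltngtP l j) lj => // lj _.
  have : forall m, (m < j)%N -> (T j < T (j - m.+1))%N.
    elim=> [|m IH] mj; first by have := down (j - 1)%N; rewrite -subSn // subn1 /=; apply; lia.
    apply: ltn_trans (IH (ltnW mj)) _.
    have := down (j - m.+2)%N; rewrite -subSn // subSS; apply; lia.
  by move=> /(_ (j - l.+1)%N); rewrite -subSn // subSS subKn ?(ltnW lj) //; apply; lia.
have : forall m, (j.+2 + m <= t)%N -> (T j < T (j.+2 + m))%N.
  elim=> [|m IH] mj; first by rewrite addn0 -eqj; apply: up; lia.
  by apply: ltn_trans (IH _) _; [lia | rewrite addnS; apply: up; lia].
move=> /(_ (l - j.+2)%N); rewrite subnKC; last by move: lj1; lia.
by apply.
Qed.

(** * Standard monomials *)

(** The value 0 out of range produces the zero corner of the Hankel matrix. *)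
Definition nat_var (k : fieldType) n (i : nat) : {mpoly k[n]} :=
  match (insub i : option 'I_n) with Some l => 'X_l | None => 0 end.

Lemma nat_varE (k : fieldType) n i (h : (i < n)%N) : nat_var k n i = 'X_(Ordinal h).
Proof. by rewrite /nat_var insubT. Qed.

Lemma nat_var_ord (k : fieldType) n (i : 'I_n) : nat_var k n i = 'X_i.
Proof. by rewrite (nat_varE k (ltn_ord i)); congr ('X__); apply: val_inj. Qed.

Lemma nat_var_out (k : fieldType) n i : (n <= i)%N -> nat_var k n i = 0.
Proof. by move=> h; rewrite /nat_var insubF // ltnNge h. Qed.

Lemma iota_index_iota n : iota 0 n = index_iota 0 n.
Proof. by rewrite /index_iota subn0. Qed.

Section Filtration.
Variables (k : fieldType) (n : nat).
Implicit Types (m : 'X_{1..n}) (p q : {mpoly k[n]}).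

Definition energy m := (\sum_(i < n) m i * i ^ 2)%N.

Lemma energyD m1 m2 : energy (m1 + m2)%MM = (energy m1 + energy m2)%N.
Proof. by rewrite -big_split; apply: eq_bigr => i _; rewrite mnmDE mulnDl. Qed.

Lemma energyU (i : 'I_n) : energy U_(i)%MM = (i ^ 2)%N.
Proof.
rewrite /energy (bigD1 i) //= mnm1E eqxx mul1n big1 ?addn0 // => j ji.
by rewrite mnm1E eq_sym (negPf ji).
Qed.

(** Weights are bounded in each degree; this makes the inductions along increasing weight
    terminate. *)
Lemma energy_le m : (energy m <= mdeg m * n.-1 ^ 2)%N.
Proof.
rewrite mdegE big_distrl; apply: leq_sum => i _; rewrite leq_mul2l leq_sqr.
by apply/orP; right; have := ltn_ord i; lia.
Qed.

Definition homog_ge d E p := forall m, m \in msupp p -> mdeg m = d /\ (E <= energy m)%N.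

Lemma homog_ge0 d E : homog_ge d E 0.
Proof. by move=> m; rewrite msupp0. Qed.

Lemma homog_geD d E p q : homog_ge d E p -> homog_ge d E q -> homog_ge d E (p + q).
Proof. by move=> hp hq m /msuppD_le; rewrite mem_cat => /orP[/hp|/hq]. Qed.

Lemma homog_geZ d E a p : homog_ge d E p -> homog_ge d E (a *: p).
Proof. by move=> hp m /msuppZ_le /hp. Qed.

Lemma homog_ge_sum (T : Type) (r : seq T) (P : pred T) (F : T -> {mpoly k[n]}) d E :
  (forall i, P i -> homog_ge d E (F i)) -> homog_ge d E (\sum_(i <- r | P i) F i).
Proof.
move=> h; elim/big_ind: _ => //; [exact: homog_ge0 | exact: homog_geD].
Qed.

Lemma homog_geM d d' E E' p q : homog_ge d E p -> homog_ge d' E' q ->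
  homog_ge (d + d') (E + E') (p * q).
Proof.
move=> hp hq m /msuppM_le /allpairsP[[m1 m2] /= [/hp[<- h1] /hq[<- h2] ->]].
by rewrite mdegD energyD leq_add.
Qed.

Lemma homog_ge_weak d E E' p : (E' <= E)%N -> homog_ge d E p -> homog_ge d E' p.
Proof. by move=> le hp m /hp[-> h]; split=> //; exact: leq_trans le h. Qed.

Lemma homog_geX m : homog_ge (mdeg m) (energy m) 'X_[m].
Proof. by move=> m'; rewrite msuppX inE => /eqP ->. Qed.

Lemma homog_ge_var i : homog_ge 1 (i ^ 2) (nat_var k n i).
Proof.
have [h|h] := ltnP i n; last by rewrite nat_var_out //; exact: homog_ge0.
by rewrite (nat_varE k h); have := @homog_geX U_(Ordinal h); rewrite mdeg1 energyU.
Qed.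

Lemma homog_ge_prod (r : seq nat) :
  homog_ge (size r) (\sum_(x <- r) x ^ 2) (\prod_(x <- r) nat_var k n x).
Proof.
elim: r => [|x r IH]; last first.
  by rewrite !big_cons -[size _]/(1 + size r)%N; apply: homog_geM IH; exact: homog_ge_var.
rewrite !big_nil -mpolyX0 => m; rewrite msuppX inE => /eqP ->.
by rewrite mdeg0.
Qed.

Definition mnm_seq (s : seq nat) : 'X_{1..n} := [multinom count_mem (val i) s | i < n].

Lemma mnm_seq_cons x s (h : (x < n)%N) : mnm_seq (x :: s) = (U_(Ordinal h) + mnm_seq s)%MM.
Proof. by apply/mnmP => i; rewrite mnmDE !mnmE /= -val_eqE. Qed.

Lemma mnm_seq_props s : all (fun x => x < n)%N s ->
  [/\ mdeg (mnm_seq s) = size s, energy (mnm_seq s) = (\sum_(x <- s) x ^ 2)%N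
    & \prod_(x <- s) nat_var k n x = 'X_[mnm_seq s]].
Proof.
elim: s => [|x s IH] /=.
  have -> : mnm_seq [::] = 0%MM by apply/mnmP => i; rewrite !mnmE.
  by rewrite !big_nil mdeg0 mpolyX0 /energy big1 // => i _; rewrite mnmE mul0n.
case/andP => h /IH[e1 e2 e3]; rewrite (mnm_seq_cons s h) mdegD mdeg1 e1 energyD energyU e2.
by rewrite !big_cons e3 (nat_varE k h) mpolyXD.
Qed.

End Filtration.

(** * Leading terms of maximal minors and reduction to normal form *)

Section Straightening.
Variables (k : fieldType) (t N n : nat).
Hypotheses (t0 : (0 < t)%N) (tN : (t <= N)%N) (Nn : (N <= n)%N).
Implicit Types (m u : 'X_{1..n}) (p q : {mpoly k[n]}) (c : nat -> nat).

Definition max_minor c : {mpoly k[n]} := hankel_det (nat_var k n) t id c.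

Definition good_cols c := increasing t c /\ (c t.-1 < N)%N.

Definition antidiag c := [seq (c j + (t.-1 - j))%N | j <- iota 0 t].

Definition mid i := (t.-1 <= i < N)%N.

Lemma good_cols_mid c : good_cols c -> forall x, x \in antidiag c -> mid x /\ (x <= c t.-1)%N.
Proof.
move=> [hc cN] x /mapP[j]; rewrite mem_iota add0n => /andP[_ jt] ->.
have h : forall d, (d <= t.-1)%N -> (c (t.-1 - d) + d <= c t.-1)%N.
  elim=> [|d IH] hd; first by rewrite subn0 addn0.
  have := hc (t.-1 - d.+1)%N (t.-1 - d)%N; have := IH (ltnW hd); lia.
have hj : (j <= t.-1)%N by lia.
have := h (t.-1 - j)%N (leq_subr _ _); rewrite subKn // => h1; have := increasing_geq hc jt.
by rewrite /mid; split=> //; lia.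
Qed.

Lemma antidiag_lt c : good_cols c -> all (fun x => x < n)%N (antidiag c).
Proof.
move=> hc; apply/allP => x /(good_cols_mid hc)[/andP[_ h] _].
exact: leq_trans h Nn.
Qed.

Lemma sum_antidiag c (f : nat -> nat) :
  (\sum_(x <- antidiag c) f x = \sum_(i < t) f (c i + (t.-1 - i)))%N.
Proof. by rewrite big_map iota_index_iota big_mkord. Qed.

Lemma size_antidiag c : size (antidiag c) = t.
Proof. by rewrite size_map size_iota. Qed.

Lemma energy_antidiag c : good_cols c ->
  energy (mnm_seq n (antidiag c)) = antidiag_energy t c.
Proof.
by move=> hc; have [_ -> _] := mnm_seq_props k (antidiag_lt hc); rewrite sum_antidiag.
Qed.

Lemma mdeg_antidiag c : good_cols c -> mdeg (mnm_seq n (antidiag c)) = t.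
Proof.
by move=> hc; have [-> _ _] := mnm_seq_props k (antidiag_lt hc); rewrite size_antidiag.
Qed.

(** In the Leibniz expansion the reversal permutation gives the antidiagonal term, and every other
    term has strictly larger weight by [perm_energy_min]. *)
Lemma max_minor_lead c : good_cols c -> exists2 a : k, a != 0 &
  homog_ge t (antidiag_energy t c).+1 (max_minor c - a *: 'X_[mnm_seq n (antidiag c)]).
Proof.
move=> hc; pose s0 : 'S_t := perm (@rev_ord_inj t).
have es0 : s0 =1 @rev_ord t by move=> i; rewrite permE.
exists ((-1) ^+ s0); first by rewrite signr_eq0.
have prodE (s : 'S_t) : \prod_(i < t) nat_var k n (i + c (s i)) =
    \prod_(x <- [seq (i + c (s i))%N | i : 'I_t]) nat_var k n x.
  by rewrite big_map big_enum.
rewrite /max_minor /hankel_det /determinant (bigD1 s0) //=.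
have -> : \prod_i (\matrix_(i0, j) nat_var k n (i0 + c j)) i (s0 i) = 'X_[mnm_seq n (antidiag c)].
  have [_ _ <-] := mnm_seq_props k (antidiag_lt hc).
  rewrite big_map iota_index_iota big_mkord (reindex_inj rev_ord_inj) /=.
  apply: eq_bigr => i _; rewrite mxE es0 rev_ordK addnC /=; congr (nat_var k n (_ + _)).
  by lia.
have -> : (-1) ^+ s0 * 'X_[mnm_seq n (antidiag c)] = (-1) ^+ s0 *: 'X_[mnm_seq n (antidiag c)] :> {mpoly k[n]}.
  by rewrite -mul_mpolyC rmorphXn rmorphN rmorph1.
rewrite addrAC subrr add0r; apply: homog_ge_sum => s ns.
have -> : (-1) ^+ s * \prod_i (\matrix_(i0, j) nat_var k n (i0 + c j)) i (s i) =
    (-1) ^+ s *: \prod_(x <- [seq (i + c (s i))%N | i : 'I_t]) nat_var k n x.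
  rewrite -mul_mpolyC rmorphXn rmorphN rmorph1; congr (_ * _); rewrite -prodE.
  by apply: eq_bigr => i _; rewrite mxE.
apply: homog_geZ.
have := @homog_ge_prod k n [seq (i + c (s i))%N | i : 'I_t].
rewrite size_map -cardE card_ord big_map big_enum /=.
apply: homog_ge_weak; have := perm_energy_min (proj1 hc) es0 ns.
rewrite /perm_energy; apply: leq_trans; rewrite ltnS /antidiag_energy.
rewrite [X in (_ <= X)%N](reindex_inj rev_ord_inj) /=.
apply: leq_sum => i _; rewrite es0 rev_ordK /= addnC leq_sqr leq_add2r; lia.
Qed.

Definition mid_deg m := (\sum_(i < n | mid i) m i)%N.

Definition mnm_nat m (x : nat) : nat := if insub x is Some i then m i else 0%N.

Lemma mnm_nat_ord m (i : 'I_n) : mnm_nat m i = m i.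
Proof. by rewrite /mnm_nat valK. Qed.

Definition mids m :=
  sort leq (flatten [seq nseq (mnm_nat m x) x | x <- iota t.-1 (N - t.-1)]).

Lemma mid_iota x : (x \in iota t.-1 (N - t.-1)) = mid x.
Proof. by rewrite mem_iota /mid; lia. Qed.

Lemma count_mids m x : count_mem x (mids m) = if mid x then mnm_nat m x else 0%N.
Proof.
rewrite /mids (seq.permP (permEl (perm_sort _ _))) -mid_iota.
have : uniq (iota t.-1 (N - t.-1)) by exact: iota_uniq.
elim: (iota _ _) => //= y r IH /andP[yr ur]; rewrite count_cat IH // inE count_nseq /=.
case: (eqVneq y x).
  by move=> e; rewrite -e (negPf yr) mul1n addn0.
by rewrite mul0n.
Qed.

Lemma size_mids m : size (mids m) = mid_deg m.
Proof.
rewrite size_sort size_flatten /shape -map_comp.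
rewrite (eq_map (g := mnm_nat m)); last by move=> x /=; rewrite size_nseq.
rewrite sumnE big_map /mid_deg.
rewrite [RHS](@eq_bigr _ _ _ _ _ _ _ (fun i : 'I_n => mnm_nat m i)); last first.
  by move=> i _; rewrite mnm_nat_ord.
rewrite -(big_mkord mid (mnm_nat m)).
have -> : iota t.-1 (N - t.-1) = [seq x <- index_iota 0 n | mid x].
  apply: (irr_sorted_eq ltn_trans ltnn); first exact: iota_ltn_sorted.
    by apply: sorted_filter; [exact: ltn_trans | rewrite /index_iota subn0; exact: iota_ltn_sorted].
  move=> x; rewrite mid_iota mem_filter mem_index_iota /mid; move: Nn; lia.
by rewrite big_filter.
Qed.

Lemma mids_sorted m : sorted leq (mids m).
Proof. by apply: sort_sorted => x y; exact: leq_total. Qed.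

Lemma mem_mids m x : x \in mids m -> mid x /\ mnm_nat m x != 0%N.
Proof. by rewrite -has_pred1 has_count count_mids lt0n; case: (mid x). Qed.

Lemma antidiag_sorted c : good_cols c -> sorted leq (antidiag c).
Proof.
move=> [hc _]; apply/(sortedP 0%N) => i; rewrite size_antidiag => hi.
rewrite !(nth_map 0%N) ?size_iota ?(ltnW hi) // !nth_iota ?(ltnW hi) // !add0n.
by have := hc i i.+1; lia.
Qed.

(** Under this condition the antidiagonal indices of c are the t smallest middle indices of the
    product monomial, so the multiple of the minor by u is the preferred one. *)
Definition allowed u c := forall i : 'I_n, mid i -> u i != 0%N -> (c t.-1 <= i)%N.

Lemma mids_allowed u c : good_cols c -> allowed u c ->
  mids (u + mnm_seq n (antidiag c)) = antidiag c ++ mids u.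
Proof.
move=> hc hu; apply: (sorted_eq leq_trans anti_leq).
- exact: mids_sorted.
- have := mids_sorted u; have := antidiag_sorted hc.
  rewrite !sorted_pairwise; try exact: leq_trans.
  rewrite pairwise_cat => -> ->; rewrite !andbT.
  apply/allrelP => x y /(good_cols_mid hc)[_ hx] /mem_mids[my].
  rewrite /mnm_nat; case: insubP => [i _ ei|//] ui.
  by apply: leq_trans hx _; rewrite -ei; apply: hu; rewrite ?ei.
apply/allP => x _ /=; apply/eqP; rewrite count_cat !count_mids.
case: ifPn => [mx|/negPf nmx]; last first.
  rewrite addn0; apply/esym/eqP; rewrite -leqn0 leqNgt -has_count has_pred1.
  by apply/negP => /(good_cols_mid hc)[]; rewrite nmx.
have xn : (x < n)%N by apply: leq_trans Nn; case/andP: mx.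
by rewrite /mnm_nat insubT mnmDE mnmE addnC.
Qed.

(** Inverse of [antidiag]: recovers the columns from the antidiagonal indices. *)
Definition cols (b : seq nat) j := (nth 0%N b j - (t.-1 - j))%N.

Lemma cols_antidiag c j : (j < t)%N -> cols (antidiag c) j = c j.
Proof.
by move=> jt; rewrite /cols (nth_map 0%N) ?size_iota // nth_iota // add0n addnK.
Qed.

(* The preferred multiple of a minor with leading monomial m: the minor takes
   the t smallest middle indices of m. *)
Definition straight m : {mpoly k[n]} :=
  let b := take t (mids m) in 'X_[m - mnm_seq n b] * max_minor (cols b).

Lemma straight_allowed u c : good_cols c -> allowed u c ->
  straight (u + mnm_seq n (antidiag c)) = 'X_[u] * max_minor c.
Proof.
move=> hc hu; have eb : take t (mids (u + mnm_seq n (antidiag c))) = antidiag c.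
  rewrite (mids_allowed hc hu); apply: take_size_cat; exact: size_antidiag.
rewrite /straight eb addmK.
have -> // : max_minor (cols (antidiag c)) = max_minor c.
by apply: eq_hankel_det => i hi; rewrite ?cols_antidiag.
Qed.

Lemma mid_deg_allowed u c : good_cols c -> allowed u c ->
  (t <= mid_deg (u + mnm_seq n (antidiag c)))%N.
Proof. by move=> hc hu; rewrite -size_mids mids_allowed // size_cat size_antidiag leq_addr. Qed.

(** The t smallest middle indices of m, in increasing order, become strictly increasing columns once
    the row t-1-j is subtracted from the j-th. *)
Lemma high_form m : (t <= mid_deg m)%N ->
  exists u c, [/\ good_cols c, m = (u + mnm_seq n (antidiag c))%MM
    & straight m = 'X_[u] * max_minor c].
Proof.
rewrite -size_mids => hm; set b := take t (mids m).
have sb : size b = t by rewrite size_takel.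
have bmid x : x \in b -> mid x by move=> /mem_take /mem_mids[].
have bnth j : (j < t)%N -> mid (nth 0%N b j) by move=> jt; apply: bmid; rewrite mem_nth ?sb.
have bs : sorted leq b by apply: take_sorted; exact: mids_sorted.
have e : antidiag (cols b) = b.
  apply: (@eq_from_nth _ 0%N); rewrite size_antidiag ?sb // => j jt.
  rewrite (nth_map 0%N) ?size_iota // nth_iota // add0n subnK //.
  by case/andP: (bnth j jt); lia.
have gc : good_cols (cols b).
  split.
    move=> i j /andP[ij jt]; rewrite /cols.
    have := sorted_leq_nth leq_trans leqnn 0%N bs; move/(_ i j).
    rewrite !inE sb jt (ltn_trans ij jt) (ltnW ij) => /(_ isT isT isT).
    case/andP: (bnth i (ltn_trans ij jt)); case/andP: (bnth j jt); lia.
  have lt : (t.-1 < t)%N by lia.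
  by rewrite /cols subnn subn0; case/andP: (bnth _ lt).
exists (m - mnm_seq n b)%MM, (cols b); split=> //.
rewrite e submK //; apply/mnm_lepP => i; rewrite mnmE.
apply: (@leq_trans (count_mem (val i) (mids m))).
  by rewrite -[mids m](cat_take_drop t) count_cat leq_addr.
by rewrite count_mids mnm_nat_ord; case: ifP.
Qed.

Lemma straight_lead m : (t <= mid_deg m)%N -> exists2 a : k, a != 0 &
  homog_ge (mdeg m) (energy m).+1 (straight m - a *: 'X_[m]).
Proof.
move=> /high_form[u [c [gc em ->]]]; have [a a0 ha] := max_minor_lead gc.
exists a => //; rewrite em mpolyXD scalerAr -mulrBr mdegD energyD energy_antidiag //.
by rewrite (mdeg_antidiag gc) -addnS; apply: homog_geM ha; exact: homog_geX.
Qed.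

Definition standard p := forall m, m \in msupp p -> (mid_deg m < t)%N.

Lemma standard0 : standard 0.
Proof. by move=> m; rewrite msupp0. Qed.

Lemma standardD p q : standard p -> standard q -> standard (p + q).
Proof. by move=> hp hq m /msuppD_le; rewrite mem_cat => /orP[/hp|/hq]. Qed.

Lemma standardZ a p : standard p -> standard (a *: p).
Proof. by move=> hp m /msuppZ_le /hp. Qed.

(** Division with remainder: a monomial with at least t middle factors is replaced by the tail of
    [straight m], of the same degree and larger weight. The control of degree and weight in the
    conclusion serves in the proof that [delta] is regular. *)
Lemma standard_span (J : {pred {mpoly k[n]}}) : weak_ideal J ->
  (forall c, good_cols c -> max_minor c \in J) ->
  forall d E p, homog_ge d E p ->
    exists q, [/\ q \in J, standard (p - q) & homog_ge d E (p - q)].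
Proof.
move=> wJ hJ d E p.
pose claim p E := exists q, [/\ q \in J, standard (p - q) & homog_ge d E (p - q)].
have claimD p1 p2 F : claim p1 F -> claim p2 F -> claim (p1 + p2) F.
  move=> [q1 [h1 h2 h3]] [q2 [h4 h5 h6]]; exists (q1 + q2).
  by rewrite opprD addrACA; split; [exact: wiD | exact: standardD | exact: homog_geD].
have claimZ a p1 F : claim p1 F -> claim (a *: p1) F.
  move=> [q1 [h1 h2 h3]]; exists (a *: q1); rewrite -scalerBr.
  split; [|exact: standardZ|exact: homog_geZ].
  by rewrite -mul_mpolyC; exact: wiM.
have claim0 F : claim 0 F.
  by exists 0; rewrite subr0; split; [exact: wi0|exact: standard0|exact: homog_ge0].
have claimW p1 F F' : (F' <= F)%N -> claim p1 F -> claim p1 F'.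
  by move=> le [q1 [h1 h2 h3]]; exists q1; split=> //; exact: homog_ge_weak h3.
suff H : forall A m, mdeg m = d -> (d * n.-1 ^ 2 - energy m < A)%N -> claim 'X_[m] (energy m).
  move=> hp; rewrite [p]mpolyE big_seq -/(claim _ E).
  elim/big_ind: _ => [||m /hp[dm Em]]; [exact: claim0 | by move=> *; exact: claimD |].
  by apply: (claimZ); apply: claimW Em _; exact: H dm (ltnSn _).
elim=> // A IH m dm hA; have [lo|hi] := ltnP (mid_deg m) t.
  exists 0; rewrite subr0; split; first exact: wi0.
    by move=> m'; rewrite msuppX inE => /eqP ->.
  by rewrite -dm; exact: homog_geX.
have [a a0 ha] := straight_lead hi.
have -> : 'X_[m] = a^-1 *: (straight m) + (- a^-1) *: (straight m - a *: 'X_[m]).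
  by rewrite scalerBr scaleNr addrA subrr sub0r scaleNr opprK scalerA mulVf // scale1r.
apply: (claimD).
  exists (a^-1 *: straight m); rewrite subrr; split; [|exact: standard0|exact: homog_ge0].
  have [u [c [gc _ ->]]] := high_form hi.
  by rewrite -mul_mpolyC; apply: (wiM wJ); apply: (wiM wJ); exact: hJ.
apply: (claimZ); rewrite dm in ha; move: ha; set r := _ - _ => ha.
rewrite [r]mpolyE big_seq.
apply: (big_ind (fun x => claim x (energy m))); first exact: claim0.
  by move=> x y hx hy; exact: claimD.
move=> m' /ha[dm' Em']; apply: (claimZ); apply: (claimW _ (energy m')); first exact: ltnW.
apply: IH => //; have := energy_le m'; rewrite dm' => h.
apply: (@leq_trans (d * n.-1 ^ 2 - energy m)); last exact: hA.
by rewrite ltn_sub2l // (leq_trans Em' h).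
Qed.

Lemma standard_decomposition p (J : {pred {mpoly k[n]}}) : weak_ideal J ->
  (forall c, good_cols c -> max_minor c \in J) -> exists2 q, q \in J & standard (p - q).
Proof.
move=> wJ hJ; rewrite [p]mpolyE; elim: (msupp p) => [|m r [q qJ hq]].
  by exists 0; rewrite ?big_nil ?subr0; [exact: wi0 | exact: standard0].
have [q' [q'J hq' _]] := standard_span wJ hJ (@homog_geX k n m).
exists (p@_m *: q' + q); first by apply: (wiD wJ) => //; rewrite -mul_mpolyC; exact: wiM.
by rewrite big_cons opprD addrACA -scalerBr; apply: standardD => //; exact: standardZ.
Qed.

End Straightening.

(** * Straightening *)

Lemma increasing_step t c : (forall i, (i.+1 < t)%N -> (c i < c i.+1)%N) -> increasing t c.
Proof.
move=> h i j /andP[ij jt]; elim: j ij jt => // j IH; rewrite ltnS leq_eqVlt.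
move=> /orP[/eqP ->|ij] jt; first exact: h.
by apply: ltn_trans (IH ij (ltnW jt)) (h _ jt).
Qed.

Lemma ltn_bump l i j : (i < j)%N -> (bump l i < bump l j)%N.
Proof. by rewrite /bump; case: leqP; case: leqP; lia. Qed.

Lemma mcoeff_sum_msupp (R : nzRingType) n (g : {mpoly R[n]})
    (s : 'X_{1..n} -> {mpoly R[n]}) m0 : m0 \in msupp g ->
  (forall m, m \in msupp g -> m != m0 -> (s m)@_m0 = 0) ->
  (\sum_(m <- msupp g) g@_m *: s m)@_m0 = g@_m0 * (s m0)@_m0.
Proof.
move=> hm0 hs; rewrite raddf_sum (bigD1_seq m0) ?msupp_uniq //= mcoeffZ.
rewrite big_seq_cond big1 ?addr0 // => m /andP[mg ne].
by rewrite mcoeffZ hs // mulr0.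
Qed.

Section Independence.
Variables (k : fieldType) (t N n : nat).
Hypotheses (t0 : (0 < t)%N) (tN : (t <= N)%N) (Nn : (N <= n)%N).
Implicit Types (m u : 'X_{1..n}) (p q : {mpoly k[n]}) (c : nat -> nat).

Local Notation max_minor := (max_minor k t n).
Local Notation good_cols := (good_cols t N).
Local Notation allowed := (allowed t N).
Local Notation straight := (@straight k t N n).
Local Notation mid_deg := (@mid_deg t N n).
Local Notation mid := (mid t N).
Local Notation standard := (@standard k t N n).

Definition hankel_ideal : {pred {mpoly k[n]}} :=
  ideal_gen (fun p => exists2 c, good_cols c & p = max_minor c).

Lemma hankel_ideal_weak : weak_ideal hankel_ideal.
Proof. exact: ideal_gen_weak. Qed.

Lemma max_minor_in c : good_cols c -> max_minor c \in hankel_ideal.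
Proof. by move=> hc; apply: mem_ideal_gen; exists c. Qed.

Definition straightened p := exists2 s : seq (k * 'X_{1..n}),
  (forall x, x \in s -> (t <= mid_deg x.2)%N) & p = \sum_(x <- s) x.1 *: straight x.2.

Lemma straightened0 : straightened 0.
Proof. by exists [::]; rewrite ?big_nil. Qed.

Lemma straightenedD p q : straightened p -> straightened q -> straightened (p + q).
Proof.
move=> [s hs ->] [s' hs' ->]; exists (s ++ s'); last by rewrite big_cat.
by move=> x; rewrite mem_cat => /orP[/hs|/hs'].
Qed.

Lemma straightenedZ a p : straightened p -> straightened (a *: p).
Proof.
move=> [s hs ->]; exists [seq (a * x.1, x.2) | x <- s].
  by move=> _ /mapP[x /hs hx ->].
by rewrite big_map scaler_sumr; apply: eq_bigr => x _; rewrite scalerA.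
Qed.

Lemma straightened_sum (T : Type) (r : seq T) (P : pred T) (F : T -> {mpoly k[n]}) :
  (forall i, P i -> straightened (F i)) -> straightened (\sum_(i <- r | P i) F i).
Proof.
by move=> h; elim/big_ind: _ => //; [exact: straightened0 | exact: straightenedD].
Qed.

Lemma straightened_sign a p : straightened p -> straightened ((-1) ^+ a * p).
Proof.
move=> hp; rewrite -signr_odd; case: (odd a); rewrite ?expr0 ?mul1r // expr1 mulN1r.
by rewrite -scaleN1r; exact: straightenedZ.
Qed.

(* Column j of d is the new one: with row t-1-j it carries the entry x_i, and
   removing it gives back c. *)
Lemma insert_column c i : good_cols c -> mid i -> (i < c t.-1)%N ->
  exists j d, [/\ [/\ (j < t)%N, (t.-1 - j + d j)%N = i & increasing t.+1 d],
    forall l, (l < t)%N -> d (bump j l) = c l,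
    forall l, (l <= t)%N -> good_cols (d \o bump l)
    & (i < d j.+1 + (t.-1 - j))%N].
Proof.
move=> [hc cN] /andP[ti iN] ic.
have ex : exists j, (i < c j + (t.-1 - j))%N by exists t.-1; rewrite subnn addn0.
(* j is the first position whose antidiagonal index exceeds i; the new column is inserted just
   before it. *)
case: (ex_minnP ex) => j hj jmin.
have jt : (j <= t.-1)%N by apply: jmin; rewrite subnn addn0.
have jt' : (j < t)%N by lia.
pose d l := if (l < j)%N then c l else if l == j then (i - (t.-1 - j))%N else c l.-1.
have dE : d j = (i - (t.-1 - j))%N by rewrite /d ltnn eqxx.
have dlt l : (l < j)%N -> d l = c l by rewrite /d => ->.
have dgt l : (j < l)%N -> d l = c l.-1 by move=> h; rewrite /d ltnNge ltnW //= gtn_eqF.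
have hd : increasing t.+1 d.
  apply: increasing_step => l; rewrite ltnS => lt.
  case: (ltngtP l j) => lj.
  - rewrite (dlt l lj); case: (ltngtP l.+1 j) => lj'.
    + by rewrite dlt //; apply: hc; lia.
    + by move: lj lj'; lia.
    + rewrite lj' dE; have := jmin l; case: (ltnP i (c l + (t.-1 - l))%N) => [_ /(_ isT)|h _].
        by rewrite leqNgt lj.
      by move: h lj'; lia.
  - by rewrite dgt ?(dgt l.+1) ?ltnS ?(ltnW lj) //=; apply: hc; lia.
  - by rewrite lj dE dgt //=; lia.
exists j, d; split=> //.
- by split=> //; rewrite dE; lia.
- move=> l lt; rewrite /bump; case: leqP => h; first by rewrite dgt // add1n.
  by rewrite dlt // add0n.
- move=> l lt; split.
    move=> x y /andP[xy yt]; apply: hd; rewrite ltn_bump //=.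
    by rewrite /bump; case: leqP; lia.
  have : (d (bump l t.-1) <= d t)%N.
    have : (bump l t.-1 <= t)%N by rewrite /bump; case: leqP; lia.
    rewrite leq_eqVlt => /orP[/eqP -> //|h]; apply: ltnW; apply: hd.
    by rewrite h ltnSn.
  by move=> h; apply: leq_ltn_trans h _; rewrite dgt.
- by rewrite dgt.
Qed.

(* Induction on the energy, which increases, and then on the sum of the indices
   of the antidiagonal, which decreases. *)
Lemma straightened_max_minor u c : good_cols c -> straightened ('X_[u] * max_minor c).
Proof.
move=> gc; have [dg du] : exists dg, (mdeg u + t)%N = dg by exists (mdeg u + t)%N.
have [B hB] : exists B, (\sum_(x <- antidiag t c) x < B)%N by eexists; exact: ltnSn.
have [A hA] : exists A, ((dg * n.-1 ^ 2).+1 - (energy u + antidiag_energy t c) < A)%N.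
  by eexists; exact: ltnSn.
move: A B u c gc hB du hA.
(* [A] bounds what is missing to the largest weight in this degree, [B] the sum of the antidiagonal
   indices. *)
elim=> // A IHA; elim=> // B IHB u c gc hB du hA.
have [al|nal] := pselect (allowed u c).
  exists [:: (1, (u + mnm_seq n (antidiag t c))%MM)] => [x|].
    by rewrite inE => /eqP -> /=; exact: mid_deg_allowed.
  by rewrite big_seq1 scale1r straight_allowed.
have [i [mi ui ic]] : exists i : 'I_n, [/\ mid i, u i != 0%N & (i < c t.-1)%N].
  apply: contrapT => h; apply: nal => i mi ui; rewrite leqNgt; apply/negP => lt.
  by apply: h; exists i.
have [j [d [[jt jE hd] bj gd ij]]] := insert_column gc mi ic.
have rel := @hankel_relation _ (nat_var k n) t (t.-1 - j) d.
have {}rel := rel (ltac:(lia)).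
have jt1 : (j < t.+1)%N by lia.
have mc : hankel_det (nat_var k n) t id (d \o bump j) = max_minor c.
  by apply: eq_hankel_det => // l lt; rewrite /= bj.
rewrite (bigD1 (Ordinal jt1)) //= jE nat_var_ord mc in rel.
pose u' := (u - U_(i))%MM.
have eu : u = (u' + U_(i))%MM by rewrite submK // lep1mP.
(* Solve the determinantal relation for its term at column j, which is x_i times the given minor. *)
have -> : 'X_[u] * max_minor c = (-1) ^+ (t + j).+1 * ('X_[u'] *
    \sum_(l < t.+1 | l != Ordinal jt1)
      (-1) ^+ (t + l) * (nat_var k n (t.-1 - j + d l) * hankel_det (nat_var k n) t id (d \o bump l))).
  have -> : \sum_(l < t.+1 | l != Ordinal jt1) (-1) ^+ (t + l) *
     (nat_var k n (t.-1 - j + d l) * hankel_det (nat_var k n) t id (d \o bump l)) =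
     - ((-1) ^+ (t + j) * ('X_i * max_minor c)).
    by apply/eqP; rewrite -addr_eq0 addrC; apply/eqP.
  have ss : (-1) ^+ (t + j) * (-1) ^+ (t + j) = 1 :> {mpoly k[n]} by rewrite -expr2 sqrr_sign.
  have e Y : (-1) ^+ (t + j) * ((-1) ^+ (t + j) * Y) = Y :> {mpoly k[n]} by rewrite mulrA ss mul1r.
  by rewrite exprS mulN1r mulrN mulrNN [in RHS]mulrCA e mulrA -mpolyXD -eu.
apply: straightened_sign; rewrite mulr_sumr; apply: straightened_sum => l lj.
rewrite mulrCA; apply: straightened_sign; rewrite mulrA.
have lt : (l <= t)%N by rewrite -ltnS.
have gl := gd l lt; have g_j := gd j (ltnW jt).
have [h|h] := ltnP (t.-1 - j + d l) n; last first.
  by rewrite nat_var_out // mulr0 mul0r; exact: straightened0.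
rewrite (nat_varE k h) -mpolyXD -/(max_minor _).
have ej : (t.-1 - j + j)%N = t.-1 by lia.
have [eT ltT] := antidiag_energy_bump ej jt hd lt.
have eC : antidiag_energy t (d \o bump j) = antidiag_energy t c.
  by apply: eq_bigr => x _; rewrite /= bj.
have du' : (mdeg (u' + U_(Ordinal h)) + t)%N = dg.
  by rewrite -du [in RHS]eu !mdegD !mdeg1.
have energy_u : energy u = (energy u' + i ^ 2)%N by rewrite {1}eu energyD energyU.
rewrite jE eC in eT ltT.
have dA : (energy u + antidiag_energy t c <= dg * n.-1 ^ 2)%N.
  have := energy_le (u + mnm_seq n (antidiag t c)).
  by rewrite energyD mdegD (energy_antidiag k t0 tN Nn gc) (mdeg_antidiag k t0 tN Nn gc) du.
(* The term at j + 1 has the same weight but replaces an antidiagonal index by the smaller i; all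
   other terms have larger weight. *)
have [el|nl] := eqVneq (l : nat) j.+1.
  apply: IHB => //; last first.
    move: hA; rewrite energyD energyU energy_u /=; move: eT; rewrite -el; clear; lia.
  have := hB; rewrite !sum_antidiag; rewrite ltnS; apply: leq_trans.
  rewrite (bigD1 (Ordinal jt)) //= [in X in (_ <= X)%N](bigD1 (Ordinal jt)) //= el.
  have -> : (\sum_(x < t | x != Ordinal jt) (d (bump j.+1 x) + (t.-1 - x)) =
      \sum_(x < t | x != Ordinal jt) (c x + (t.-1 - x)))%N.
    apply: eq_bigr => x; rewrite -val_eqE /= => xj; rewrite -(bj x) // /bump.
    by rewrite [(j <= x)%N]leq_eqVlt eq_sym (negPf xj).
  rewrite -(bj j jt) /bump ltnn leqnn add0n add1n.
  by move: ij jE; move: (\sum_(_ < t | _) _)%N => S; move: jt; clear; lia.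
apply: IHA (ltnSn _) du' _ => //.
have := ltT; rewrite -val_eqE /= in lj; rewrite lj nl => /(_ isT).
move: hA; rewrite energyD energyU energy_u /=; move: dA; rewrite energy_u; clear; lia.
Qed.

Lemma hankel_ideal_straightened p : p \in hankel_ideal -> straightened p.
Proof.
move=> /asboolP[s hs ->]; rewrite big_seq; apply: straightened_sum => x /hs[c gc ->].
rewrite [x.1]mpolyE mulr_suml; apply: straightened_sum => m _.
by rewrite -scalerAl; apply: straightenedZ; exact: straightened_max_minor.
Qed.

(** Distinct straight products have distinct leading monomials, none of them standard. In a
    nontrivial combination a leading monomial of least weight cannot cancel, so the sum is not
    standard. *)
Lemma straightened_standard p : straightened p -> standard p -> p = 0.
Proof.
move=> [s hs ep] hp; pose g := \sum_(x <- s) x.1 *: 'X_[k, x.2].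
pose K := (\max_(x <- s) (mdeg x.2).+1)%N.
have hK x : x \in s -> (mdeg x.2 < K)%N.
  by move=> xs; apply: (leq_bigmax_seq (F := fun x : k * 'X_{1..n} => (mdeg x.2).+1)).
have gE (m : 'X_{1..n}) : g@_m = \sum_(x <- s | x.2 == m) x.1.
  rewrite raddf_sum [RHS]big_mkcond; apply: eq_bigr => x _ /=.
  by rewrite mcoeffZ mcoeffX; case: ifP; rewrite ?mulr1 ?mulr0.
clearbody g; have gs m : m \in msupp g -> (t <= mid_deg m)%N /\ (mdeg m < K)%N.
  rewrite mcoeff_msupp gE => h.
  have [x xs <-] : exists2 x, x \in s & x.2 = m.
    apply: contrapT => hn; case/eqP: h; rewrite big_seq_cond big1 // => x /andP[xs /eqP ex].
    by case: hn; exists x.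
  by split; [exact: hs | exact: hK].
(* Equal monomials are collected; the degree bound [K] makes the monomials involved range over a
   finite type. *)
have pE : p = \sum_(m <- msupp g) g@_m *: straight m.
  have -> : \sum_(m <- msupp g) g@_m *: straight m =
      \sum_(m : 'X_{1..n < K}) g@_m *: straight m.
    rewrite [RHS](bigID (fun m : 'X_{1..n < K} => val m \in msupp g)) /=.
    rewrite [X in _ + X]big1 ?addr0; last by move=> m /memN_msupp_eq0 ->; rewrite scale0r.
    have -> : \sum_(m : 'X_{1..n < K} | val m \in msupp g) g@_m *: straight m =
        \sum_(m <- [seq val m | m : 'X_{1..n < K} ] | m \in msupp g) g@_m *: straight m.
      by rewrite big_map big_enum_cond.
    rewrite -[RHS]big_filter; apply: perm_big; apply: uniq_perm.
    - exact: msupp_uniq.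
    - rewrite filter_uniq // map_inj_uniq ?enum_uniq //; exact: val_inj.
    move=> m; rewrite mem_filter; case: (boolP (m \in msupp g)) => //= mg.
    apply/esym/mapP; exists (BMultinom (proj2 (gs m mg))) => //; exact: mem_enum.
  rewrite ep; under [RHS]eq_bigr => m _ do rewrite gE scaler_suml big_mkcond /=.
  rewrite exchange_big /= !big_seq; apply: eq_bigr => x xs.
  rewrite (bigD1 (BMultinom (hK x xs))) //= eqxx big1 ?addr0 // => m.
  by rewrite -val_eqE /= eq_sym => /negPf ->.
have [g0|/eqP g0] := pselect (g = 0); first by rewrite pE g0 msupp0 big_nil.
have ex : exists e, has (fun m => energy m == e) (msupp g).
  exists (energy (mlead g)); apply/hasP; exists (mlead g) => //; exact: mlead_supp.
case: (ex_minnP ex) => e /hasP[m0 m0g /eqP em0] emin.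
have [h0 _] := gs m0 m0g; have [a a0 _] := straight_lead k t0 tN Nn h0.
suff : m0 \in msupp p by move/hp; rewrite ltnNge h0.
have lead m : m \in msupp g -> exists2 a : k, a != 0 & (straight m)@_m0 = a *+ (m == m0).
  move=> mg; have [hm _] := gs m mg; have [b b0 hb] := straight_lead k t0 tN Nn hm.
  exists b => //; rewrite -[straight m](subrK (b *: 'X_[m])) mcoeffD mcoeffZ mcoeffX.
  rewrite memN_msupp_eq0 ?add0r ?mulr_natr //; apply/negP => /hb[_].
  apply/negP; rewrite -leqNgt em0; apply: emin; apply/hasP; by exists m.
have [b b0 hb] := lead m0 m0g; rewrite mcoeff_msupp.
have -> : p@_m0 = g@_m0 * b.
  rewrite eqxx mulr1n in hb; rewrite -hb pE; apply: (mcoeff_sum_msupp m0g) => m mg /negPf ne.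
  by have [b' _ ->] := lead m mg; rewrite ne mulr0n.
by rewrite mulf_neq0 // -mcoeff_msupp.
Qed.

Lemma standard_independent p : p \in hankel_ideal -> standard p -> p = 0.
Proof. by move=> /hankel_ideal_straightened; exact: straightened_standard. Qed.

End Independence.

(** * Minors of the square Hankel matrix *)

Section MinorShift.
Variables (R : comNzRingType) (x : nat -> R) (t : nat).
Implicit Types (a c : nat -> nat) (S : {set 'I_t}).

Definition shift S a i : nat :=
  (a i + (if (insub i : option 'I_t) is Some j then j \in S else false))%N.

Lemma shift_ord S a (i : 'I_t) : shift S a i = (a i + (i \in S))%N.
Proof. by rewrite /shift valK. Qed.

Lemma shift_bounds S a i : (a i <= shift S a i <= (a i).+1)%N.
Proof. by rewrite /shift leq_addr -addn1 leq_add2l; case: insub => // j; case: (_ \in _). Qed.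

(** In the Leibniz term of a permutation s, shifting the rows in S has the same effect as shifting
    the columns in s(S), and S -> s(S) permutes the sets of given size. *)
Lemma hankel_det_shift a c p :
  \sum_(S : {set 'I_t} | #|S| == p) hankel_det x t (shift S a) c =
  \sum_(S : {set 'I_t} | #|S| == p) hankel_det x t a (shift S c).
Proof.
rewrite /hankel_det /determinant exchange_big [RHS]exchange_big; apply: eq_bigr => s _ /=.
rewrite -!mulr_sumr; congr (_ * _).
have sinj : injective (fun S => s @: S) by apply: imset_inj; exact: perm_inj.
rewrite [RHS](reindex_inj sinj); apply: eq_big => [S|S _].
  by rewrite card_imset //; exact: perm_inj.
apply: eq_bigr => i _; rewrite !mxE !shift_ord mem_imset; last exact: perm_inj.
by rewrite addnAC addnA.
Qed.

Lemma hankel_det_tr a c : hankel_det x t a c = hankel_det x t c a.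
Proof.
by rewrite /hankel_det -det_tr; congr (\det _); apply/matrixP => i j; rewrite !mxE addnC.
Qed.

Lemma hankel_det_weak a c : (forall i, (i.+1 < t)%N -> (c i <= c i.+1)%N) ->
  increasing t c \/ hankel_det x t a c = 0.
Proof.
move=> hc; have [h|h] := pselect (forall i, (i.+1 < t)%N -> (c i < c i.+1)%N).
  by left; exact: increasing_step.
right; have [i [it ei]] : exists i, (i.+1 < t)%N /\ c i = c i.+1.
  apply: contrapT => h'; apply: h => i it; rewrite ltn_neqAle hc // andbT.
  by apply/eqP => e; apply: h'; exists i.
rewrite hankel_det_tr; pose i1 := Ordinal (ltnW it); pose i2 := Ordinal it.
apply: (@determinant_alternate _ _ _ i1 i2).
  by rewrite -val_eqE /= neq_ltn ltnSn.
by move=> j; rewrite !mxE /= ei.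
Qed.

Lemma hankel_det_shift_weak S a c : increasing t c ->
  increasing t (shift S c) \/ hankel_det x t a (shift S c) = 0.
Proof.
move=> hc; apply: hankel_det_weak => i it.
have /andP[_ h1] := shift_bounds S c i; have /andP[h2 _] := shift_bounds S c i.+1.
apply: leq_trans h1 (leq_trans _ h2); apply: hc; by rewrite ltnSn.
Qed.

Lemma sum_top_set S (j : nat) (S0 := [set i : 'I_t | (j <= i)%N]) :
  #|S| = #|S0| -> S != S0 -> (\sum_(i in S) i < \sum_(i in S0) i)%N.
Proof.
move=> eS nS; rewrite (big_setID S0) [X in (_ < X)%N](big_setID S) /= setIC ltn_add2l.
have ec : #|S :\: S0| = #|S0 :\: S|.
  by apply/eqP; rewrite -(eqn_add2l #|S :&: S0|) cardsID setIC cardsID eS.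
have c0 : (0 < #|S :\: S0|)%N.
  rewrite lt0n cards_eq0 setD_eq0; apply: contra nS => sub.
  by rewrite eqEcard sub eS leqnn.
apply: (@leq_trans (#|S :\: S0| * j)).
  have : (\sum_(i in S :\: S0) i.+1 <= \sum_(i in S :\: S0) j)%N.
    by apply: leq_sum => i; rewrite !inE -ltnNge => /andP[].
  rewrite sum_nat_const; apply: leq_trans.
  under [X in (_ <= X)%N]eq_bigr => i _ do rewrite -addn1.
  by rewrite big_split /= sum1_card -addn1 leq_add2l.
rewrite ec -sum_nat_const; apply: leq_sum => i; by rewrite !inE => /andP[_].
Qed.

Variables (J : {pred R}) (wJ : weak_ideal J) (w L : nat).
Hypothesis tw : (t <= w)%N.

(** An invariant of moving one unit from the last row to the last column. As long as the last row is
    at least w, the bound on the sum leaves room for the column to grow. *)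
Let bounded a c := [/\ increasing t a, increasing t c, (a t.-1 + c t.-1 <= L)%N
  & (c t.-1 + w <= L.+1)%N].

Hypothesis base : forall a c, bounded a c -> (a t.-1 < w)%N -> hankel_det x t a c \in J.

(* Shift by one the rows after the first gap: in [hankel_det_shift] the other
   terms have a smaller sum of rows, or the same sum of rows and a smaller value
   of the sum of the i * a_i. *)
Lemma reduce_rows a c : (0 < t)%N -> bounded a c -> hankel_det x t a c \in J.
Proof.
move=> t0.
have [A hA] : exists A, (\sum_(i < t) a i < A)%N by eexists; exact: ltnSn.
have [B hB] : exists B, (\sum_(i < t) i * a i < B)%N by eexists; exact: ltnSn.
move: A B a c hA hB; elim=> // A IHA; elim=> // B IHB a c hA hB bac.
have [lt|ge] := ltnP (a t.-1) w; first exact: base.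
have [ha hc hL hw] := bac; have tt : (t.-1 < t)%N by lia.
have ex : exists j, (j < t)%N && (j < a j)%N by exists t.-1; rewrite tt; lia.
(* The rows 0, ..., j - 1 are in place, and [b] below moves all later rows down by one. *)
case: (ex_minnP ex) => j /andP[jt ja] jmin.
have eqa i : (i < j)%N -> a i = i.
  move=> ij; apply/eqP; rewrite eqn_leq (increasing_geq ha) ?(ltn_trans ij) // andbT.
  by rewrite leqNgt; apply/negP => h; have := jmin i; rewrite (ltn_trans ij jt) h /= => /(_ isT); lia.
pose S0 : {set 'I_t} := [set i : 'I_t | (j <= i)%N].
pose b i := (a i - (j <= i))%N.
have apos i : (i < t)%N -> (j <= i)%N -> (0 < a i)%N.
  by move=> it ji; apply: leq_ltn_trans (leq0n j) _; apply: leq_trans ja _;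
    move: ji; rewrite leq_eqVlt => /orP[/eqP -> //|ji]; apply: ltnW; apply: ha; rewrite ji.
have hb : increasing t b.
  apply: increasing_step => i it; have := ha i i.+1; rewrite ltnSn it => /(_ isT) h.
  rewrite /b; case: (ltngtP j i.+1) => ji.
  - have -> : (j <= i)%N by lia.
    by have := apos i (ltnW it); lia.
  - have -> : (j <= i)%N = false by lia.
    by lia.
  - have -> : (j <= i)%N = false by lia.
    by rewrite subn0 eqa ?ji // -ji subn1; lia.
have eS0 i : (i < t)%N -> shift S0 b i = a i.
  move=> it; rewrite -[i]/(nat_of_ord (Ordinal it)) shift_ord inE /b /=.
  by case: leqP => h; rewrite ?subn0 ?addn0 // subnK // apos.
have -> : hankel_det x t a c = \sum_(S : {set 'I_t} | #|S| == #|S0|) hankel_det x t b (shift S c)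
    - \sum_(S : {set 'I_t} | (#|S| == #|S0|) && (S != S0)) hankel_det x t (shift S b) c.
  rewrite -hankel_det_shift (bigD1 S0) //= addrK.
  by apply: eq_hankel_det => // i it; rewrite eS0.
have bt : b t.-1 = (a t.-1).-1.
  rewrite /b; have -> : (j <= t.-1)%N by lia.
  by rewrite subn1.
have at0 : (0 < a t.-1)%N by lia.
apply: (wiB wJ); apply: (wi_sum wJ) => S.
  move=> _; case: (hankel_det_shift_weak S b hc) => [hS|->]; last exact: wi0.
  have sumb : (\sum_(i < t) b i < \sum_(i < t) a i)%N.
    rewrite (bigD1 (Ordinal jt)) //= [X in (_ < X)%N](bigD1 (Ordinal jt)) //=.
    rewrite -addSn leq_add //; first by rewrite /b leqnn; lia.
    by apply: leq_sum => i _; rewrite leq_subr.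
  apply: (IHA (\sum_(i < t) i * b i).+1) => //; first exact: leq_trans sumb _.
  have /andP[_ hS1] := shift_bounds S c t.-1.
  by split=> //; rewrite ?bt; lia.
move=> /andP[/eqP cS nS].
rewrite hankel_det_tr; case: (hankel_det_shift_weak S c hb) => [hS|->]; last exact: wi0.
have sumE (f : nat -> nat) S' : (\sum_(i < t) f i * shift S' b i =
    \sum_(i < t) f i * b i + \sum_(i in S') f i)%N.
  rewrite [X in (_ + X)%N]big_mkcond -big_split; apply: eq_bigr => i _ /=.
  by rewrite shift_ord mulnDr; case: (i \in S'); rewrite ?muln1 ?muln0.
have sumE0 (f : nat -> nat) : (\sum_(i < t) f i * a i = \sum_(i < t) f i * b i + \sum_(i in S0) f i)%N.
  by rewrite -(sumE f S0); apply: eq_bigr => i _; rewrite eS0.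
have sum1 S' : (\sum_(i < t) shift S' b i = \sum_(i < t) b i + #|S'|)%N.
  rewrite -sum1_card [X in (_ + X)%N]big_mkcond -big_split; apply: eq_bigr => i _ /=.
  by rewrite shift_ord; case: (i \in S').
rewrite hankel_det_tr; apply: IHB => //.
- rewrite sum1 cS -sum1; move: hA; congr (_ < _)%N.
  by apply: eq_bigr => i _; rewrite eS0.
- have := hB; rewrite (sumE id S) (sumE0 id) ltnS; apply: leq_trans.
  by rewrite ltn_add2l; exact: sum_top_set.
- have /andP[_ hS1] := shift_bounds S b t.-1.
  by split=> //; rewrite bt in hS1; lia.
Qed.

End MinorShift.

Section HankelMinors.
Variables (k : fieldType) (m r t : nat).
Hypotheses (hr : (r + 2 <= m)%N) (t0 : (0 < t)%N) (tm : (t <= m)%N).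
Let n := (2 * m - r - 1)%N.
Let N := minn (2 * m - t) n.

(** [reduce_rows] is used in both directions. With w = t the rows of a minor are brought to 0, ...,
    t-1 while the last column stays below 2m - t. Conversely, after transposition and with w = m, a
    maximal minor is expressed by minors with rows and columns below m. *)
Lemma minors_ideal_hankel : minors_ideal t (hankel k m r) =i @hankel_ideal k t N n.
Proof.
have tt : (t.-1 < t)%N by lia.
move=> p; apply/idP/idP; move: p; apply: ideal_gen_min; try exact: ideal_gen_weak.
  move=> p [f [g [hf hg ->]]].
  pose a i := if (insub i : option 'I_t) is Some j then nat_of_ord (f j) else 0%N.
  pose c i := if (insub i : option 'I_t) is Some j then nat_of_ord (g j) else 0%N.
  have aE (i : 'I_t) : a i = f i by rewrite /a valK.
  have cE (i : 'I_t) : c i = g i by rewrite /c valK.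
  have inc_a : increasing t a.
    move=> i j /andP[ij jt]; have it := ltn_trans ij jt.
    by rewrite (aE (Ordinal it)) (aE (Ordinal jt)); exact: hf.
  have inc_c : increasing t c.
    move=> i j /andP[ij jt]; have it := ltn_trans ij jt.
    by rewrite (cE (Ordinal it)) (cE (Ordinal jt)); exact: hg.
  have -> : \det (mxsub f g (hankel k m r)) = hankel_det (nat_var k n) t a c.
    by congr (\det _); apply/matrixP => i j; rewrite !mxE aE cE.
  have am : (a t.-1 < m)%N by rewrite (aE (Ordinal tt)).
  have cm : (c t.-1 < m)%N by rewrite (cE (Ordinal tt)).
  apply: (@reduce_rows _ _ _ _ (@hankel_ideal_weak _ _ _ _) t (2 * m - 2)) => //; last first.
    by split=> //; lia.
  move=> {inc_a inc_c am cm aE cE} a' c' [ha hc hL hw] at'.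
  have ea i : (i < t)%N -> a' i = id i.
    move=> it; apply/eqP; rewrite eqn_leq (increasing_geq ha it) andbT.
    have H : forall d, (d <= t.-1)%N -> (a' (t.-1 - d) + d <= t.-1)%N.
      elim=> [|d IH] hd; first by rewrite subn0 addn0; lia.
      have := ha (t.-1 - d.+1)%N (t.-1 - d)%N; have := IH (ltnW hd); lia.
    by have := H (t.-1 - i)%N (leq_subr _ _); rewrite subKn; lia.
  rewrite (eq_hankel_det _ ea (fun _ _ => erefl)).
  have [cn|cn] := ltnP (c' t.-1) n.
    apply: max_minor_in; split=> //; rewrite /N leq_min cn andbT; lia.
  (* The last column starts at an index at least n, hence is zero. *)
  have -> : hankel_det (nat_var k n) t id c' = 0; last exact: wi0 (@hankel_ideal_weak _ _ _ _).
  rewrite /hankel_det (expand_det_col _ (Ordinal tt)) big1 // => i _.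
  by rewrite mxE /= nat_var_out ?mul0r // (leq_trans cn) // leq_addl.
move=> p [c [hc cN] ->]; rewrite /max_minor hankel_det_tr.
have wM : weak_ideal (minors_ideal t (hankel k m r)) by exact: ideal_gen_weak.
apply: (@reduce_rows _ _ _ _ wM m (2 * m - 2)) => //; last first.
  split=> //; last by lia.
    by move=> i j /andP[].
  by move: cN; rewrite /N leq_min => /andP[h _]; lia.
move=> a c' [ha hc' hL hw] am; have cm : (c' t.-1 < m)%N by lia.
have bnd f : increasing t f -> (f t.-1 < m)%N -> forall i, (i < t)%N -> (f i < m)%N.
  move=> hf fm i it; have [->//|ne] := eqVneq i t.-1.
  by apply: leq_trans fm; apply: ltnW; rewrite ltnS; apply: hf; lia.
apply: mem_ideal_gen.
exists (fun i : 'I_t => Ordinal (bnd a ha am i (ltn_ord i))).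
exists (fun i : 'I_t => Ordinal (bnd c' hc' cm i (ltn_ord i))).
split=> [i j ij|i j ij|]; [by apply: ha; rewrite ij ltn_ord|by apply: hc'; rewrite ij ltn_ord|].
by congr (\det _); apply/matrixP => i j; rewrite !mxE.
Qed.

End HankelMinors.

(** * Freeness of the quotient *)

Section Freeness.
Variables (k : fieldType) (hk : [pchar k] =i pred0) (t N n : nat).
Hypotheses (t0 : (0 < t)%N) (tN : (t <= N)%N) (Nn : (N <= n)%N).
Variables (I : {pred {mpoly k[n]}}) (hI : idealr_closed I).
Hypothesis IE : I =i @hankel_ideal k t N n.

Let d := (n - N + t.-1)%N.

(** [outer] enumerates the variables that are not middle: the first t - 1, then those from x_N
    on. *)
Let outer_lt (i : 'I_d) : ((if i < t.-1 then i : nat else i + (N - t.-1)) < n)%N.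
Proof. by move: (nat_of_ord i) (ltn_ord i) => x; rewrite /d; case: (ltnP x t.-1); lia. Qed.

Let outer (i : 'I_d) : 'I_n := Ordinal (outer_lt i).

Let outer_inj : injective outer.
Proof.
move=> i j /(congr1 val) /= e; apply: val_inj; move: e => /=.
by move: (nat_of_ord i) (nat_of_ord j) => x y; case: (ltnP x t.-1); case: (ltnP y t.-1); lia.
Qed.

Let outer_mid (i : 'I_d) : mid t N (outer i) = false.
Proof. by rewrite /mid /=; move: (nat_of_ord i) (ltn_ord i) => x; rewrite /d; case: (ltnP x t.-1); lia. Qed.

Let outer_onto (j : 'I_n) : ~~ mid t N j -> exists i, outer i = j.
Proof.
rewrite /mid => mj; have lj := ltn_ord j.
have lt : ((if j < t.-1 then j : nat else j - (N - t.-1)) < d)%N.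
  by rewrite /d; move: (nat_of_ord j) mj lj => x; case: (ltnP x t.-1); lia.
exists (Ordinal lt); apply: val_inj => /=; move: (nat_of_ord j) mj lj => x mj lj.
by case: (ltnP x t.-1) => h; case: ltnP; lia.
Qed.

(** [om] embeds the outer monomials, while [ro] and [mi] extract the outer and middle parts of a
    monomial. *)
Let om (al : 'X_{1..d}) : 'X_{1..n} := (\sum_(i < d) U_(outer i) *+ al i)%MM.
Let ro (m : 'X_{1..n}) : 'X_{1..d} := [multinom m (outer i) | i < d].
Let mi (m : 'X_{1..n}) : 'X_{1..n} := [multinom if mid t N j then m j else 0%N | j < n].

Let om_outer al i : om al (outer i) = al i.
Proof.
rewrite /om mnm_sumE (bigD1 i) //= mulmnE mnm1E eqxx mul1n big1 ?addn0 // => j ji.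
by rewrite mulmnE mnm1E (inj_eq outer_inj) (negPf ji).
Qed.

Let om_mid al (j : 'I_n) : mid t N j -> om al j = 0%N.
Proof.
move=> mj; rewrite /om mnm_sumE big1 // => i _; rewrite mulmnE mnm1E.
by case: eqVneq => // e; rewrite -e outer_mid in mj.
Qed.

Let mnm_split m : m = (om (ro m) + mi m)%MM.
Proof.
apply/mnmP => j; rewrite mnmDE [mi m j]mnmE; case: ifPn => [mj|/outer_onto[i <-]].
  by rewrite om_mid.
by rewrite om_outer mnmE addn0.
Qed.

Let mi_om al m : mi m = m -> mi (om al + m)%MM = m.
Proof.
move=> e; apply/mnmP => j; rewrite mnmE -[in RHS]e [RHS]mnmE mnmDE.
by case: ifPn => // mj; rewrite om_mid.
Qed.

Let mid_deg_mi m : mid_deg t N m = mdeg (mi m).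
Proof.
rewrite mdegE /mid_deg big_mkcond; apply: eq_bigr => j _; by rewrite mnmE.
Qed.

Let basis := [set m : 'X_{1..n < t} | mi m == m].
Let q := #|basis|.
Let mu (j : 'I_q) : 'X_{1..n} := bmnm (enum_val j).

Let mu_mi j : mi (mu j) = mu j.
Proof. by apply/eqP; have := enum_valP j; rewrite inE. Qed.

Let mu_inj : injective mu.
Proof. by move=> i j /val_inj /enum_val_inj. Qed.

Let mu_deg j : (mdeg (mu j) < t)%N.
Proof. exact: bmdeg. Qed.

Let mu_onto m : (mdeg m < t)%N -> mi m = m -> exists j, mu j = m.
Proof.
move=> hm e; have hB : BMultinom hm \in basis by rewrite inE /= e.
by exists (enum_rank_in hB (BMultinom hm)); rewrite /mu enum_rankK_in.
Qed.

Let iota0 : {rmorphism {mpoly k[d]} -> {mpoly k[n]}} := mmap (@mpolyC n k) (fun i => 'X_(outer i)).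

Let iota0E p : iota0 p = \sum_(al <- msupp p) p@_al *: 'X_[om al].
Proof.
rewrite /iota0 /= /mmap; apply: eq_bigr => al _; rewrite mul_mpolyC; congr (_ *: _).
by rewrite /mmap1 /om -mprodXnE.
Qed.

Let iota0X al : iota0 'X_[al] = 'X_[om al].
Proof. by rewrite iota0E msuppX big_seq1 mcoeffX eqxx scale1r. Qed.

Let iota0C c : iota0 c%:MP = c%:MP.
Proof. exact: mmapC. Qed.

Let iota : {rmorphism {mpoly k[d]} -> quotient_ring hI} := qproj hI \o iota0.
Let e (j : 'I_q) : quotient_ring hI := qproj hI 'X_[mu j].

Let standard_expand p : standard t N p -> exists a : 'I_q -> {mpoly k[d]},
  p = \sum_j iota0 (a j) * 'X_[mu j].
Proof.
move=> hp; rewrite [p]mpolyE big_seq.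
pose claim x := exists a : 'I_q -> {mpoly k[d]}, x = \sum_j iota0 (a j) * 'X_[mu j].
apply: (big_ind claim).
- by exists (fun=> 0); rewrite big1 // => j _; rewrite rmorph0 mul0r.
- move=> _ _ [a ->] [b ->]; exists (fun j => a j + b j).
  by rewrite -big_split; apply: eq_bigr => j _; rewrite rmorphD mulrDl.
move=> m /hp; rewrite mid_deg_mi => hm.
have mimi : mi (mi m) = mi m by apply/mnmP => j; rewrite [LHS]mnmE [RHS]mnmE; case: ifP => // mj; rewrite mnmE mj.
have [j0 ej] := mu_onto hm mimi.
exists (fun j => if j == j0 then p@_m *: 'X_[ro m] else 0).
rewrite (bigD1 j0) //= eqxx big1 ?addr0; last first.
  by move=> j /negPf ->; rewrite rmorph0 mul0r.
by rewrite ej -!mul_mpolyC rmorphM iota0C iota0X -mulrA -mpolyXD -mnm_split.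
Qed.

Let standard_sum (a : 'I_q -> {mpoly k[d]}) :
  standard t N (\sum_j iota0 (a j) * 'X_[mu j]).
Proof.
apply: (big_ind (@standard k t N n)).
- exact: standard0.
- by move=> x y; exact: standardD.
move=> j _; rewrite iota0E mulr_suml; apply: (big_ind (@standard k t N n)).
- exact: standard0.
- by move=> x y; exact: standardD.
move=> al _; rewrite -scalerAl -mpolyXD; apply: standardZ => m.
by rewrite msuppX inE => /eqP ->; rewrite mid_deg_mi (mi_om _ (mu_mi j)) mu_deg.
Qed.

(** A product of an outer and a middle monomial determines both factors, so each coefficient of each
    a_j is a coefficient of the sum. *)
Let sum_eq0 (a : 'I_q -> {mpoly k[d]}) :
  \sum_j iota0 (a j) * 'X_[mu j] = 0 -> forall j, a j = 0.
Proof.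
move=> h j; apply/mpolyP => al; rewrite mcoeff0.
have := congr1 (mcoeff (om al + mu j)%MM) h; rewrite mcoeff0 => <-.
have coefE j' : (iota0 (a j') * 'X_[mu j'])@_(om al + mu j) = if j' == j then (a j)@_al else 0.
  case: eqVneq => [->|ne].
    rewrite addmC mcoeffMX iota0E raddf_sum /=; have [hal|hal] := boolP (al \in msupp (a j)).
      rewrite (bigD1_seq al) ?msupp_uniq //= mcoeffZ mcoeffX eqxx mulr1 big1 ?addr0 // => b ba.
      rewrite mcoeffZ mcoeffX; case: eqVneq => [eb|]; last by rewrite mulr0.
      by case/eqP: ba; apply/mnmP => i; rewrite -om_outer eb om_outer.
    rewrite big_seq big1 ?(memN_msupp_eq0 hal) // => b hb.
    rewrite mcoeffZ mcoeffX; case: eqVneq => [eb|]; last by rewrite mulr0.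
    suff ab : b = al by rewrite ab (negPf hal) in hb.
    by apply/mnmP => i; rewrite -om_outer eb om_outer.
  rewrite iota0E mulr_suml raddf_sum /= big1 // => b _.
  rewrite -scalerAl -mpolyXD mcoeffZ mcoeffX; case: eqVneq => [eb|]; last by rewrite mulr0.
  case/eqP: ne; apply: mu_inj; have := congr1 mi eb; by rewrite !(mi_om _ (mu_mi _)).
rewrite raddf_sum /=; under eq_bigr => j' _ do rewrite coefE.
by rewrite -big_mkcond big_pred1_eq.
Qed.

Let wI : weak_ideal I := idealr_closed_weak hI.

Let span b : exists a : 'I_q -> {mpoly k[d]}, b = \sum_j iota (a j) * e j.
Proof.
have [f ->] := qproj_surj b.
have hJ c : good_cols t N c -> max_minor k t n c \in I.
  by move=> hc; rewrite IE; exact: max_minor_in.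
have [g gI hg] := standard_decomposition t0 tN Nn f wI hJ.
have [a ea] := standard_expand hg; exists a.
have -> : \sum_j iota (a j) * e j = qproj hI (\sum_j iota0 (a j) * 'X_[mu j]).
  by rewrite rmorph_sum; apply: eq_bigr => j _; rewrite rmorphM.
rewrite -ea; apply/eqP; rewrite -subr_eq0 -rmorphB qproj_eq0 opprB addrC subrK //.
Qed.

Let indep (a : 'I_q -> {mpoly k[d]}) : \sum_j iota (a j) * e j = 0 -> forall j, a j = 0.
Proof.
move=> h; apply: sum_eq0; apply: (@standard_independent k t N n t0 tN Nn); last exact: standard_sum.
rewrite -IE -(qproj_eq0 hI); apply/eqP; rewrite -[RHS]h rmorph_sum.
by apply: eq_bigr => j _; rewrite rmorphM.
Qed.

Let iotaC c : iota c%:MP = qproj hI c%:MP.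
Proof. by rewrite -iota0C. Qed.

Lemma hankel_cohen_macaulay : cohen_macaulay (quotient_ring hI).
Proof. exact: (@free_cohen_macaulay k hk n d q I hI iota e span indep). Qed.

Lemma hankel_codim : codim I (N - t.-1).
Proof.
have -> : (N - t.-1 = n - d)%N by rewrite /d; lia.
exact: (@free_codim k hk n d q I hI iota e iotaC span indep).
Qed.

End Freeness.

Section Properness.
Variables (k : fieldType) (t N n : nat).
Hypotheses (t0 : (0 < t)%N) (tN : (t <= N)%N) (Nn : (N <= n)%N).

(** The polynomial 1 is standard and nonzero. *)
Lemma hankel_ideal_proper : idealr_closed (@hankel_ideal k t N n).
Proof.
apply: weak_ideal_closed; first exact: hankel_ideal_weak.
apply/negP => h; have := standard_independent t0 tN Nn h.
have h1 : standard t N (1 : {mpoly k[n]}).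
  move=> m; rewrite -mpolyX0 msuppX inE => /eqP ->.
  by rewrite /mid_deg big1 // => i _; rewrite mnm0E.
by move/(_ h1)/eqP; rewrite oner_eq0.
Qed.

End Properness.

(** * Primality *)

Lemma ker_prime (R : comNzRingType) (F : idomainType) (phi : {rmorphism R -> F})
    (I : {pred R}) : weak_ideal I -> (forall x, (x \in I) = (phi x == 0)) -> prime_ideal I.
Proof.
move=> wI hI; split; last by move=> u v; rewrite !hI rmorphM mulf_eq0.
by apply: weak_ideal_closed => //; rewrite hI rmorph1 oner_eq0.
Qed.

Lemma rmorph_hankel_det (R S : comNzRingType) (phi : {rmorphism R -> S}) (x : nat -> R) t a c :
  phi (hankel_det x t a c) = hankel_det (phi \o x) t a c.
Proof.
rewrite /hankel_det -det_map_mx; congr (\det _).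
by apply/matrixP => i j; rewrite !mxE.
Qed.

Section Primality.
Variables (k : fieldType) (t N n : nat).
Hypotheses (t1 : (1 < t)%N) (tN : (t <= N)%N) (Nn : (N < n)%N) (nN : (n <= N + t.-1)%N).
Let t0 : (0 < t)%N := ltnW t1.
Let Nn' : (N <= n)%N := ltnW Nn.
Let s := t.-1.
Let d := (n - (N - s))%N.
Local Notation I := (@hankel_ideal k t N n).
Local Notation R := {mpoly k[n]}.

Let wI : weak_ideal I := hankel_ideal_weak k t N n.

(** Row s-1-j and column N-s+1+j add up to N: the antidiagonal of [delta] is constant, equal to
    x_N. *)
Let c0 j := (N - s + 1 + j)%N.
Let delta : R := max_minor k s n c0.

Let s0 : (0 < s)%N. Proof. by rewrite /s; lia. Qed.
Let sN : (s <= N.+1)%N. Proof. by rewrite /s; lia. Qed.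

Let good_c0 : good_cols s N.+1 c0.
Proof. by split; rewrite /c0 /s; [move=> i j /andP[]; lia | move: t1 tN; lia]. Qed.

Let antidiag_c0 : antidiag s c0 = nseq s N.
Proof.
apply: (@eq_from_nth _ 0%N); rewrite size_antidiag ?size_nseq // => i hi.
rewrite (nth_map 0%N) ?size_iota // nth_iota // nth_nseq hi /c0.
by move: hi tN; rewrite /s; lia.
Qed.

Let nu : 'X_{1..n} := mnm_seq n (nseq s N).

Let nu_outer : mid_deg t N nu = 0%N.
Proof.
rewrite /mid_deg big1 // => i /andP[_ iN]; rewrite mnmE count_nseq /= gtn_eqF //.
Qed.

Definition energy_ge E (p : R) := forall m, m \in msupp p -> (E <= energy m)%N.

Let energy_geD E p q : energy_ge E p -> energy_ge E q -> energy_ge E (p + q).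
Proof. by move=> hp hq m /msuppD_le; rewrite mem_cat => /orP[/hp|/hq]. Qed.

(** Each monomial is reduced separately, without lowering its weight; p need not be homogeneous. *)
Let energy_reduce E p : energy_ge E p -> exists g, [/\ p - g \in I, standard t N g & energy_ge E g].
Proof.
move=> hp; rewrite [p]mpolyE big_seq.
pose claim x := exists g, [/\ x - g \in I, standard t N g & energy_ge E g].
apply: (big_ind claim).
- exists 0; rewrite subr0; split; [exact: wi0|exact: standard0|by move=> m; rewrite msupp0].
- move=> x y [g [h1 h2 h3]] [g' [h4 h5 h6]]; exists (g + g').
  rewrite opprD addrACA.
  by split; [exact: (wiD wI)|exact: standardD|exact: energy_geD].
move=> m /hp hm; have [q [qI hq1 hq2]] := standard_span t0 tN Nn' wI
  (fun c hc => @max_minor_in k t N n c hc) (@homog_geX k n m).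
exists (p@_m *: ('X_[m] - q)); split.
- rewrite -scalerBr opprB addrC subrK -mul_mpolyC; exact: (wiM wI).
- exact: standardZ.
- by move=> m' /msuppZ_le /hq2[_ h]; exact: leq_trans hm h.
Qed.

(* The leading monomial of delta is a power of the outer variable x_N, so that
   multiplication by delta does not interfere with reduction to standard form. *)
Let delta_regular f : delta * f \in I -> f \in I.
Proof.
have [q qI] := standard_decomposition t0 tN Nn' f wI (fun c hc => @max_minor_in k t N n c hc).
set p := f - q => hp hf.
suff p0 : p = 0 by rewrite -[f](subrK q) -/p p0 add0r.
have {}hf : delta * p \in I.
  by rewrite /p mulrBr; apply: (wiB wI) => //; exact: (wiM wI).
clearbody p; have [//|/eqP p0] := pselect (p = 0).
have [a a0 ha] := @max_minor_lead k s N.+1 n s0 sN Nn c0 good_c0.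
have E0 := @energy_antidiag k s N.+1 n s0 sN Nn c0 good_c0.
rewrite antidiag_c0 -/nu -/delta in ha E0.
set r := delta - a *: 'X_[nu] in ha.
have ex : exists e, has (fun m => energy m == e) (msupp p).
  exists (energy (mlead p)); apply/hasP; exists (mlead p) => //; exact: mlead_supp.
case: (ex_minnP ex) => e /hasP[m0 m0p /eqP em0] emin.
have minp m : m \in msupp p -> (e <= energy m)%N.
  by move=> hm; apply: emin; apply/hasP; exists m.
have hr : energy_ge (energy nu + e).+1 (r * p).
  move=> m /msuppM_le /allpairsP[[m1 m2] /= [/ha[_ h1] /minp h2 ->]].
  by rewrite energyD E0 -addSn leq_add.
have [g [gI hg1 hg2]] := energy_reduce hr.
have st : standard t N (a *: ('X_[nu] * p) + g).
  apply: standardD => //; apply: standardZ => m /msuppM_le /allpairsP[[m1 m2] /= [h1 /hp h2 ->]].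
  move: h1; rewrite msuppX inE => /eqP ->; rewrite /mid_deg.
  under eq_bigr => i _ do rewrite mnmDE.
  by rewrite big_split /= -/(mid_deg t N nu) nu_outer add0n.
have e1 : a *: ('X_[nu] * p) + g = delta * p - (r * p - g).
  have -> : delta * p = r * p + a *: ('X_[nu] * p) by rewrite /r mulrBl -scalerAl subrK.
  by rewrite opprB [RHS]addrC [RHS]addrA subrK addrC.
(* This element is standard and in I, hence zero; yet it has a nonzero coefficient at [nu + m0], as
   all monomials of [g] have larger weight. *)
have := @standard_independent k t N n t0 tN Nn' (a *: ('X_[nu] * p) + g).
rewrite {1}e1 => /(_ (wiB wI hf gI) st) /(congr1 (mcoeff (nu + m0)%MM)).
rewrite mcoeffD mcoeffZ ['X_[nu] * p]mulrC mcoeffMX mcoeff0 [X in _ + X]memN_msupp_eq0 ?addr0.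
  by move/eqP; rewrite mulf_eq0 (negPf a0) mcoeff_eq0 m0p.
by apply/negP => /hg2; rewrite energyD em0 ltnn.
Qed.

Let delta_regularX M f : delta ^+ M * f \in I -> f \in I.
Proof.
by elim: M => [|M IH]; rewrite ?mul1r // exprS -mulrA => /delta_regular.
Qed.

Let emb_lt (i : 'I_d) : (i + (N - s) < n)%N.
Proof. by move: (nat_of_ord i) (ltn_ord i) => x; rewrite /d; lia. Qed.

(** The inclusion of the polynomial ring in the last d variables, x_(N-s), ..., x_(n-1). *)
Let kappa : {rmorphism {mpoly k[d]} -> R} :=
  mmap (@mpolyC n k) (fun i => 'X_(Ordinal (emb_lt i))).

Let kappaC c : kappa c%:MP = c%:MP.
Proof. exact: mmapC. Qed.

Let kappaX i : kappa (nat_var k d i) = nat_var k n (N - s + i).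
Proof.
have [h|h] := ltnP i d; last by rewrite !nat_var_out ?rmorph0 //; move: h; rewrite /d; lia.
rewrite (nat_varE k h) /kappa /= mmapX mmap1U -nat_var_ord /=.
by rewrite addnC.
Qed.

Let delta0 := hankel_det (nat_var k d) s id (fun j => 1 + j)%N.

Let kappa_delta : kappa delta0 = delta.
Proof.
rewrite /delta0 rmorph_hankel_det; congr (\det _); apply/matrixP => i j; rewrite !mxE /=.
by rewrite kappaX; congr nat_var; rewrite /c0; lia.
Qed.

Let delta0_neq0 : delta0 != 0.
Proof.
apply/eqP => h; have [a a0 ha] := @max_minor_lead k s N.+1 n s0 sN Nn c0 good_c0.
have E0 := @energy_antidiag k s N.+1 n s0 sN Nn c0 good_c0.
have : mnm_seq n (antidiag s c0) \in msupp (max_minor k s n c0 - a *: 'X_[mnm_seq n (antidiag s c0)]).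
  rewrite -/delta -kappa_delta h rmorph0 sub0r (perm_mem (msuppN _)).
  by rewrite mcoeff_msupp mcoeffZ mcoeffX eqxx mulr1.
by move/ha => [_]; rewrite E0 ltnn.
Qed.

(** After inverting [delta], f is congruent modulo I to a fraction in the last d variables. *)
Let Loc f := exists M g, delta ^+ M * f - kappa g \in I.

Let LocD f f' : Loc f -> Loc f' -> Loc (f + f').
Proof.
move=> [M [g h]] [M' [g' h']]; exists (M + M')%N, (delta0 ^+ M' * g + delta0 ^+ M * g').
have -> : delta ^+ (M + M') * (f + f') - kappa (delta0 ^+ M' * g + delta0 ^+ M * g') =
    delta ^+ M' * (delta ^+ M * f - kappa g) + delta ^+ M * (delta ^+ M' * f' - kappa g').
  rewrite rmorphD !rmorphM !rmorphXn kappa_delta !mulrBr addrACA -opprD; congr (_ - _).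
  by rewrite mulrDr exprD !mulrA [delta ^+ M' * _]mulrC.
exact: (wiD wI (wiM wI _ h) (wiM wI _ h')).
Qed.

Let LocM f f' : Loc f -> Loc f' -> Loc (f * f').
Proof.
move=> [M [g h]] [M' [g' h']]; exists (M + M')%N, (g * g').
have -> : delta ^+ (M + M') * (f * f') - kappa (g * g') =
    (delta ^+ M' * f') * (delta ^+ M * f - kappa g) + kappa g * (delta ^+ M' * f' - kappa g').
  rewrite rmorphM !mulrBr addrA; congr (_ - _).
  rewrite [kappa g * (delta ^+ M' * f')]mulrC subrK.
  by rewrite exprD mulrACA mulrC.
exact: (wiD wI (wiM wI _ h) (wiM wI _ h')).
Qed.

Let LocK g : Loc (kappa g).
Proof. by exists 0%N, g; rewrite mul1r subrr; exact: wi0. Qed.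

Let LocC c : Loc c%:MP.
Proof. rewrite -kappaC; exact: LocK. Qed.

Let LocI f : f \in I -> Loc f.
Proof. by move=> h; exists 0%N, 0; rewrite mul1r rmorph0 subr0. Qed.

Let LocN f : Loc f -> Loc (- f).
Proof. by move=> h; rewrite -mulN1r; apply: LocM => //; rewrite -mpolyC1 -mpolyCN; exact: LocC. Qed.

Let Loc1 : Loc 1. Proof. rewrite -mpolyC1; exact: LocC. Qed.
Let Loc0 : Loc 0. Proof. rewrite -(mpolyC0 n); exact: LocC. Qed.

Let Loc_sum (T : finType) (P : pred T) (F : T -> R) : (forall i, P i -> Loc (F i)) ->
  Loc (\sum_(i | P i) F i).
Proof. exact: (big_ind Loc Loc0 LocD). Qed.

Let Loc_prod (T : finType) (P : pred T) (F : T -> R) : (forall i, P i -> Loc (F i)) ->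
  Loc (\prod_(i | P i) F i).
Proof. exact: (big_ind Loc Loc1 LocM). Qed.

Let Loc_sign a f : Loc f -> Loc ((-1) ^+ a * f).
Proof. by move=> h; rewrite -signr_odd; case: (odd a); rewrite ?expr0 ?mul1r // mulN1r; exact: LocN. Qed.

Let Loc_det e (A : 'M[R]_e) : (forall i j, Loc (A i j)) -> Loc (\det A).
Proof.
by move=> h; apply: Loc_sum => p _; apply: Loc_sign; apply: Loc_prod.
Qed.

Let Loc_delta f : Loc (delta * f) -> Loc f.
Proof. by move=> [M [g h]]; exists M.+1, g; rewrite exprSr -mulrA. Qed.

Let Loc_high i : (N - s <= i)%N -> Loc (nat_var k n i).
Proof. by move=> h; rewrite -(subnKC h) -kappaX. Qed.

(** Descending induction on i. The minor with columns i, N-s, ..., N-1 is in I; its expansion along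
    the first column is x_i times [delta], plus later variables times cofactors in the last d
    variables. *)
Let Loc_var i : Loc (nat_var k n i).
Proof.
have [h|h] := leqP (N - s) i; first exact: Loc_high.
suff H e : forall i, (N - s <= i + e)%N -> Loc (nat_var k n i) by apply: (H (N - s)%N i); rewrite leq_addl.
elim: e => [|e IH] {h}i hi; first by apply: Loc_high; rewrite addn0 in hi.
have [h|h] := leqP (N - s) i; first exact: Loc_high.
apply: Loc_delta.
pose c j := if j is j'.+1 then (N - s + j')%N else i.
have gc : good_cols t N c.
  split; last by rewrite /c; move: t1 tN; rewrite /s; case: (t) => [//|[//|u]] /=; lia.
  by move=> a b /andP[]; case: a b => [|a] [|b] //=; move: h; rewrite /s; lia.
have mI := @max_minor_in k t N n c gc.
pose A : 'M[R]_s.+1 := \matrix_(a, b) nat_var k n (a + c b).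
have dA : \det A \in I.
  move: mI; rewrite /max_minor /hankel_det.
  by have -> : t = s.+1 by rewrite /s prednK.
rewrite (expand_det_col A ord0) big_ord_recl in dA.
have e0 : A ord0 ord0 * cofactor A ord0 ord0 = delta * nat_var k n i.
  have -> : cofactor A ord0 ord0 = delta.
    rewrite /cofactor expr0 mul1r; congr (\det _); apply/matrixP => a b; rewrite !mxE /= /bump /c0 /=.
    by congr nat_var; lia.
  have -> : A ord0 ord0 = nat_var k n i by rewrite mxE.
  exact: mulrC.
rewrite e0 in dA.
rewrite -[delta * _](addrK (\sum_(j < s) A (lift ord0 j) ord0 * cofactor A (lift ord0 j) ord0)).
apply: LocD; first exact: LocI.
apply: LocN; apply: Loc_sum => a _; apply: LocM.
  by rewrite mxE; apply: IH; rewrite /= /bump /=; lia.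
apply: Loc_sign; apply: Loc_det => a' b; rewrite !mxE /= /bump /=; apply: Loc_high.
by lia.
Qed.

Let Loc_all f : Loc f.
Proof.
rewrite [f]mpolyE big_seq; apply: (big_ind Loc Loc0 LocD) => m _.
rewrite -mul_mpolyC; apply: LocM; first exact: LocC.
rewrite mpolyXE_id; apply: Loc_prod => i _; rewrite -nat_var_ord.
by elim: (m i) => [|e IH]; rewrite ?expr0 // exprS; apply: LocM.
Qed.

Let F := {fraction {mpoly k[d]}}.
Let base (i : nat) : F := tofrac (nat_var k d i).

(* Linear recurrence of order s satisfied by the generic sequence, with
   coefficients determined by its last 2 s terms. *)
Let recurrence : exists w : 'I_s -> F, forall b, (b < s)%N ->
  base b + \sum_a w a * base (b + (1 + a)) = 0.
Proof.
pose H : 'M[F]_s := \matrix_(b, a) base (b + (1 + a)).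
have Hu : H \in unitmx.
  rewrite unitmxE unitfE.
  have -> : \det H = tofrac delta0 by rewrite /delta0 (rmorph_hankel_det (@tofrac _)).
  by rewrite tofrac_eq0 delta0_neq0.
pose v : 'cV[F]_s := invmx H *m (\col_b - base b).
exists (fun a => v a ord0) => b bs.
have := mulKVmx Hu (\col_b - base b : 'cV_s) => /matrixP/(_ (Ordinal bs) ord0).
rewrite -/v !mxE => e; apply/eqP; rewrite addrC -[base b]opprK subr_eq0; apply/eqP.
by rewrite -[RHS]e; apply: eq_bigr => a _; rewrite !mxE mulrC.
Qed.

(** I is shown to be the kernel of a morphism [phi] to the field F, namely evaluation at the
    sequence [V] obtained from the last d variables by running the recurrence backwards. *)
Lemma hankel_ideal_prime : prime_ideal I.
Proof.
have [w hw] := recurrence.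
(* [vv e] extends [base] by e terms to the left, re-indexed from 0. *)
pose vv := fix vv e : nat -> F :=
  if e is e'.+1 then fun i => if i is i'.+1 then vv e' i' else - \sum_a w a * vv e' a
  else base.
have vvE e i : vv e (e + i)%N = base i by elim: e => //= e ->.
have vv_rec e j : (j < s + e)%N -> vv e j + \sum_a w a * vv e (j + (1 + a))%N = 0.
  elim: e j => [|e IH] j; first by rewrite addn0; exact: hw.
  case: j => [|j] hj /=; first by rewrite addNr.
  by apply: IH; rewrite -ltnS -addnS.
pose V := vv (N - s)%N.
pose phi : {rmorphism R -> F} := mmap (@tofrac {mpoly k[d]} \o @mpolyC d k) (fun i => V i).
have phiX i : phi (nat_var k n i) = V i.
  have [h|h] := ltnP i n; first by rewrite (nat_varE k h) /phi /= mmapX mmap1U.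
  (* Beyond the last variable both sides vanish, as [base] is zero from index d on. *)
  rewrite nat_var_out // rmorph0 /V.
  have hi : (N - s <= i)%N by move: h Nn; lia.
  rewrite -(subnKC hi) vvE /base nat_var_out ?rmorph0 //.
  by rewrite /d; lia.
have phiK g : phi (kappa g) = tofrac g.
  apply: (@eq_rmorph_mpoly k d F (phi \o kappa) (@tofrac _)) => [c|i].
    transitivity (phi (kappa c%:MP)); first by [].
    by rewrite kappaC /phi /= mmapC.
  transitivity (phi (kappa 'X_i)); first by [].
  by rewrite -[in LHS]nat_var_ord kappaX phiX /V vvE /base nat_var_ord.
have phiI f : f \in I -> phi f = 0.
  pose K : {pred R} := fun f => phi f == 0.
  have wK : weak_ideal K.
    split; first by rewrite unfold_in rmorph0.
    by move=> a u v; rewrite !unfold_in rmorphD rmorphM => /eqP -> /eqP ->; rewrite mulr0 addr0.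
  move=> fI; apply/eqP; move: f fI; apply: (ideal_gen_min wK) => f [c [hc cN] ->].
  rewrite unfold_in /max_minor rmorph_hankel_det; apply/det0P.
  (* By the recurrence the nonzero row (1, w) kills every column, all of which start below N. *)
  exists (\row_(a < t) if (a : nat) is a'.+1 then
            (if insub a' is Some b then w b else 0) else 1).
    by apply/eqP => /rowP/(_ (Ordinal t0)); rewrite !mxE /=; apply/eqP; exact: oner_neq0.
  apply/rowP => j; rewrite !mxE.
  have cj : (c j < s + (N - s))%N.
    have : (c j <= c t.-1)%N.
      have [->//|ne] := eqVneq (j : nat) t.-1; apply: ltnW; apply: hc.
      by have := ltn_ord j; lia.
    by move: cN tN; rewrite /s; lia.
  rewrite -[RHS](vv_rec _ _ cj).
  have es : t = s.+1 by rewrite /s prednK.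
  transitivity (\sum_(a < s.+1) (if (a : nat) is a'.+1 then
     (if insub a' is Some b then w b else 0) else 1) * V (a + c j)%N).
    rewrite -(big_mkord predT (fun a => (if a is a'.+1 then
      (if insub a' is Some b then w b else 0) else 1) * V (a + c j)%N)) -es big_mkord.
    by apply: eq_bigr => a _; rewrite !mxE /= phiX.
  rewrite big_ord_recl mul1r add0n; congr (_ + _); apply: eq_bigr => a _ /=.
  by rewrite /bump /= add1n valK; congr (_ * V _); rewrite addnC.
apply: (@ker_prime _ _ phi) => // f; apply/idP/eqP => [/phiI //|h].
(* Conversely, [delta ^+ M * f] is congruent to [kappa g]; if [phi f] is zero then so is g, since
   [phi] is injective on the last d variables, and [delta] is cancelled. *)
have [M [g hg]] := Loc_all f; have := phiI _ hg.
rewrite rmorphB rmorphM h mulr0 phiK sub0r => /eqP; rewrite oppr_eq0 tofrac_eq0 => /eqP g0.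
by apply: (@delta_regularX M); rewrite g0 rmorph0 subr0 in hg.
Qed.

End Primality.

(** * The case N = n: primality for t = 1 and its failure for t > 1 *)

Section ExtremalCases.
Variables (k : fieldType).

(** All variables are middle, so a standard polynomial is constant, and I is the kernel of
    evaluation at the origin. *)
Lemma hankel_ideal_prime1 n : (0 < n)%N -> prime_ideal (@hankel_ideal k 1 n n).
Proof.
move=> n0; set I := @hankel_ideal k 1 n n; have wI : weak_ideal I by exact: hankel_ideal_weak.
apply: (@ker_prime _ _ (meval (fun=> 0))) => // f.
pose K : {pred {mpoly k[n]}} := fun f => f.@[fun=> 0] == 0.
have KE f' : (f' \in K) = (f'.@[fun=> 0] == 0) by [].
have wK : weak_ideal K.
  split; first by rewrite KE meval0.
  by move=> a u v; rewrite !KE mevalD mevalM => /eqP -> /eqP ->; rewrite mulr0 addr0.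
have IK : {subset I <= K}.
  apply: ideal_gen_min => // x [c _ ->].
  rewrite KE /max_minor /hankel_det det_mx11 mxE /nat_var.
  by case: insubP => [i _ _|_]; rewrite ?mevalXU ?meval0.
apply/idP/idP => [/IK //|]; rewrite -KE => fK.
have [q qI hq] := standard_decomposition (ltn0Sn 0) n0 (leqnn n) f wI
  (fun c hc => @max_minor_in k 1 n n c hc).
have qK := IK _ qI.
have cst : f - q = ((f - q)@_0)%:MP.
  apply: msize1_polyC; rewrite msizeE; apply/bigmax_leqP_seq => m /hq; rewrite ltnS leqn0 => /eqP h _.
  rewrite ltnS leqn0 mdeg_eq0; apply/eqP/mnmP => i; rewrite mnm0E; apply/eqP.
  by move/eqP: h; rewrite /mid_deg sum_nat_eq0 => /forallP/(_ i); rewrite /mid /= ltn_ord.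
have := wiB wK fK qK; rewrite KE cst mevalC => /eqP h0.
by rewrite -[f](subrK q) cst h0 mpolyC0 add0r.
Qed.

(* The minor with x_(n-1) on its antidiagonal vanishes below it. *)
Lemma hankel_ideal_not_prime t n : (1 < t)%N -> (t <= n)%N ->
  ~ prime_ideal (@hankel_ideal k t n n).
Proof.
move=> t1 tn [hI pI]; have t0 := ltnW t1.
have n0 : (0 < n)%N := leq_trans t0 tn.
set I := @hankel_ideal k t n n in hI pI.
pose c j := (n - t + j)%N.
have gc : good_cols t n c by split; [move=> i j /andP[ij jt]; rewrite /c; lia | rewrite /c; lia].
have an : antidiag t c = nseq t n.-1.
  apply: (@eq_from_nth _ 0%N); rewrite size_antidiag ?size_nseq // => i hi.
  by rewrite (nth_map 0%N) ?size_iota // nth_iota // nth_nseq hi /c; lia.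
have [a a0 ha] := @max_minor_lead k t n n t0 tn (leqnn n) c gc.
have cI : max_minor k t n c \in I by exact: max_minor_in.
(* The leading monomial is x_(n-1)^t, of the largest weight possible in degree t, so nothing else
   can occur in the minor. *)
have xE : max_minor k t n c = a *: 'X_[mnm_seq n (antidiag t c)].
  apply/eqP; rewrite -subr_eq0 -msupp_eq0; case E : (msupp _) => [//|m ms].
  have [|dm Em] := ha m; first by rewrite E mem_head.
  have := energy_le m; rewrite dm leqNgt; case/negP.
  apply: leq_trans Em; rewrite ltnS /antidiag_energy.
  rewrite (eq_bigr (fun=> n.-1 ^ 2)%N) ?sum_nat_const ?card_ord // => i _.
  by congr (_ ^ 2)%N; rewrite /c; have := ltn_ord i; lia.
have nn : (n.-1 < n)%N by rewrite prednK.
have xI : nat_var k n n.-1 ^+ t \in I.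
  have [_ _ e] := @mnm_seq_props k n _ (@antidiag_lt t n n t0 tn (leqnn n) c gc).
  have -> : nat_var k n n.-1 ^+ t = a^-1%:MP * max_minor k t n c.
    by rewrite xE mul_mpolyC scalerA mulVf // scale1r -e an big_nseq -Monoid.iteropE.
  exact: (wiM (idealr_closed_weak hI)).
have {}xI : nat_var k n n.-1 \in I.
  elim: (t) xI => [|e IH]; last by rewrite exprS => /pI /orP[|/IH].
  by case: hI => _ /negP h _ /h.
have := @standard_independent k t n n t0 tn (leqnn n) _ xI.
have st : standard t n (nat_var k n n.-1).
  move=> m; rewrite (nat_varE k nn) msuppX inE => /eqP ->; apply: leq_ltn_trans t1.
  rewrite /mid_deg; apply: (@leq_trans (mdeg U_(Ordinal nn))); last by rewrite mdeg1.
  by rewrite mdegE big_mkcond; apply: leq_sum => i _; case: ifP.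
by move/(_ st)/eqP; rewrite (nat_varE k nn) -msupp_eq0 msuppX.
Qed.

End ExtremalCases.

Theorem proposition2p4 (k : fieldType) (hk : [pchar k] =i pred0)
    (m r t : nat) (hr : (r + 2 <= m)%N) (ht : (1 <= t <= m)%N) :
  let I := minors_ideal t (hankel k m r) in
  (codim I (minn (2 * (m - t) + 1) (2 * m - t - r)) /\
   exists hI : idealr_closed I, cohen_macaulay (quotient_ring hI)) /\
  (prime_ideal I <-> (t = 1%N \/ (r + 2 <= t)%N)).
Proof.
move=> I; have /andP[t0 tm] := ht.
set n := (2 * m - r - 1)%N in I *; set N := minn (2 * m - t) n.
have IE : I =i @hankel_ideal k t N n by exact: minors_ideal_hankel.
have eI : I = @hankel_ideal k t N n by apply/funext => x; exact: IE.
have tN : (t <= N)%N by rewrite /N /n; lia.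
have Nn : (N <= n)%N by rewrite /N geq_minr.
have hI : idealr_closed I by rewrite eI; exact: hankel_ideal_proper.
split; first split.
- have -> : minn (2 * (m - t) + 1) (2 * m - t - r) = (N - t.-1)%N by rewrite /N /n; lia.
  exact: (@hankel_codim k hk t N n t0 tN Nn I hI IE).
- by exists hI; exact: (@hankel_cohen_macaulay k hk t N n t0 tN Nn I hI IE).
split=> [pI|].
  have [->|t1] := eqVneq t 1%N; [by left | right].
  rewrite leqNgt; apply/negP => tr.
  (* For t <= r + 1 one has n <= 2m - t. *)
  have NE : N = n by rewrite /N /n; lia.
  move: pI; rewrite eI NE; apply: hankel_ideal_not_prime; first by lia.
  by rewrite -NE.
rewrite eI; case=> [t1|rt].
  have NE : N = n by rewrite /N /n; lia.
  by rewrite t1 NE; apply: hankel_ideal_prime1; rewrite /n; lia.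
(* For t >= r + 2 one has N = 2m - t < n, and n <= 2m - 1 = N + t - 1. *)
by apply: hankel_ideal_prime => //; rewrite /N /n; lia.
Qed.
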